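(* Suppose that (i) there is a constant $c_0$ independent of $p$ and $K$ with $\frac1{c_0}\le\lambda_{\min}(\boldsymbol\Sigma)\le\lambda_{\max}(\boldsymbol\Sigma)\le c_0$; (ii) there is a constant $c_1>0$ independent of $p$ and $K$ with $\min_{1\le i\ne j\le K}(\boldsymbol\mu_i-\boldsymbol\mu_j)^{\rm T}\boldsymbol\Sigma^{-1}(\boldsymbol\mu_i-\boldsymbol\mu_j)\ge c_1$; and (iii) $\{s_n:n\ge1\}$ is a sequence of nonrandom positive numbers with $M_{max}s_n\to0$ as $n\to\infty$. Let $T$ be a rule in the family described in the context, determined by $\widehat{\mathbf a}_{ji},\widehat{\mathbf b}_{ji}$. For $1\le j\ne i\le K$ let $$\mathbf a_{ji}=t_{ji}\widehat{\mathbf a}_{ji}+(\mathbf a_{ji})_\perp$$ be the orthogonal decomposition of $\mathbf a_{ji}$, where $t_{ji}\widehat{\mathbf a}_{ji}$ ($t_{ji}\in\mathbb R$) is the orthogonal projection of $\mathbf a_{ji}$ along the direction of $\widehat{\mathbf a}_{ji}$ and $(\mathbf a_{ji})_\perp$ is orthogonal to $t_{ji}\widehat{\mathbf a}_{ji}$. Let $$\widehat d_{ji}=\widehat{\mathbf a}_{ji}^{\rm T}\boldsymbol\Sigma^{-1/2}(\widehat{\mathbf b}_{ji}-\boldsymbol\mu_i),\qquad d_{ji}=\mathbf a_{ji}^{\rm T}\boldsymbol\Sigma^{-1/2}(\mathbf b_{ji}-\boldsymbol\mu_i)=\tfrac12\|\mathbf a_{ji}\|_2^2 .$$ If $$\|\mathbf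 a_{ji}\|_2^2-\|\widehat{\mathbf a}_{ji}\|_2^2=\|\mathbf a_{ji}\|_2^2\,O_p(s_n),\qquad t_{ji}=1+O_p(s_n),\qquad d_{ji}-\widehat d_{ji}=\|\widehat{\mathbf a}_{ji}\|_2^2\,O_p(s_n),$$ where the $O_p(s_n)$ are uniform over all $1\le j\ne i\le K$, then $$\frac{R_T(\mathbf X)}{R_{OPT}}-1=O_p\Big(K^2\sqrt{M_{max}s_n\log[(M_{max}s_n)^{-1}]}\Big).$$
   Context: There are $K\ge2$ classes; an observation from the $i$th class has distribution $N_p(\boldsymbol\mu_i,\boldsymbol\Sigma)$ with common positive definite covariance $\boldsymbol\Sigma$. All classes have prior probability $1/K$. $\mathbf X=\{\mathbf x_{ij}:1\le i\le K,1\le j\le n_i\}$ is a sample of independent observations, $\mathbf x_{ij}\sim N_p(\boldsymbol\mu_i,\boldsymbol\Sigma)$, with total size $n=\sum_i n_i$. Asymptotics: $n,p\to\infty$ (so $p$, $K$, $\boldsymbol\mu_i$, $\boldsymbol\Sigma$ may vary with $n$), and $K$ is arbitrary (bounded or growing). $\lambda_{\min},\lambda_{\max}$ denote smallest and largest eigenvalues. $\mathbf a_{ji}=\boldsymbol\Sigma^{-1/2}(\boldsymbol\mu_j-\boldsymbol\mu_i)$, $\mathbf b_{ji}=\frac12(\boldsymbol\mu_j+\boldsymbol\mu_i)$, and $M_{max}=\max_{1\le i\ne j\le K}(\boldsymbol\mu_j-\boldsymbol\mu_i)^{\rm T}\boldsymbol\Sigma^{-1}(\boldsymbol\mu_j-\boldsymbol\mu_i)=\max_{i\neq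 j}\|\mathbf a_{ji}\|_2^2$ (which may tend to infinity). The optimal rule $T_{OPT}$ assigns $\mathbf x$ to the class $i$ with smallest $(\mathbf x-\boldsymbol\mu_i)^{\rm T}\boldsymbol\Sigma^{-1}(\mathbf x-\boldsymbol\mu_i)$; $R_{OPT}$ is its misclassification rate (the Bayes error). Family of rules: given $p$-vectors $\widehat{\mathbf a}_{ji},\widehat{\mathbf b}_{ji}$, possibly depending on $\mathbf X$, with $\widehat{\mathbf a}_{ji}=-\widehat{\mathbf a}_{ij}$ and $\widehat{\mathbf b}_{ji}=\widehat{\mathbf b}_{ij}$, the rule $T$ assigns a new $\mathbf x$ to the $i$th class if $\widehat{\mathbf a}_{ji}^{\rm T}\boldsymbol\Sigma^{-1/2}(\mathbf x-\widehat{\mathbf b}_{ji})<0$ for all $j\ne i$ (a point for which no such $i$ exists counts as misclassified). $R_T(\mathbf X)=\sum_{i=1}^K P(\mathbf x_{\rm new}\text{ belongs to the }i\text{th class and }T(\mathbf x_{\rm new})\ne i\mid\mathbf X)$, with $\mathbf x_{\rm new}$ a new observation independent of $\mathbf X$. ''$\xi_{ji}=O_p(s_n)$ uniformly in $j\ne i$'' means $\max_{j\ne i}|\xi_{ji}|/s_n$ is bounded in probability. *)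

(* Defs.v *)
From HB Require Import structures.
From mathcomp Require Import all_boot all_order all_algebra.
From mathcomp Require Import all_classical all_reals all_analysis.

Set Implicit Arguments.
Unset Strict Implicit.
Unset Printing Implicit Defensive.

Import Order.TTheory GRing.Theory Num.Theory.
Import numFieldNormedType.Exports.

Local Open Scope classical_set_scope.
Local Open Scope ring_scope.

(* R^p is 'cV[R]_p with its Borel sigma-algebra, generated by the coordinates. *)
Definition cV_display : measure_display.
Proof. exact: default_measure_display. Qed.

Section measurable_cV.
Context {R : realType} (p : nat).

Let coord : 'I_p -> 'cV[R]_p -> R := fun k x => x k 0.

Let cV_set0 : g_sigma_preimage coord set0.
Proof. exact: sigma_algebra0. Qed.

Let cV_setC A : g_sigma_preimage coord A -> g_sigma_preimage coord (~` A).
Proof. exact: sigma_algebraC. Qed.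

Let cV_bigcup (F : (set 'cV[R]_p)^nat) :
  (forall i, g_sigma_preimage coord (F i)) ->
  g_sigma_preimage coord (\bigcup_i (F i)).
Proof. exact: sigma_algebra_bigcup. Qed.

HB.instance Definition _ := @isMeasurable.Build cV_display
  'cV[R]_p (g_sigma_preimage coord) cV_set0 cV_setC cV_bigcup.

End measurable_cV.

Section linear_algebra.
Context {R : realType} {p : nat}.
Implicit Types (u v : 'cV[R]_p) (A S Sigma : 'M[R]_p).

Definition dot u v : R := (u^T *m v) 0 0.

Definition sqnorm u : R := dot u u.

Definition posdef A := A^T = A /\ forall u, u != 0 -> 0 < dot u (A *m u).

Definition lambda_min A : R := inf [set l | eigenvalue A l].

Definition lambda_max A : R := sup [set l | eigenvalue A l].

(* S = Sigma^{-1/2}; such an S exists and is unique when Sigma is positive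
   definite. *)
Definition is_inv_sqrt Sigma S := posdef S /\ S *m S = invmx Sigma.

Definition mahalanobis2 Sigma u v : R := dot (u - v) (invmx Sigma *m (u - v)).

(* t *: ah is the orthogonal projection of a on the line spanned by ah, and
   aperp is the remainder; t is not determined when ah = 0. *)
Definition orth_decomposition (a : 'cV[R]_p) (t : R) (ah aperp : 'cV[R]_p) :=
  a = t *: ah + aperp /\ dot aperp ah = 0.

(* N_p(mu, Sigma), Sigma positive definite, as in the usual coordinate-free
   definition of the multivariate normal distribution: every nonzero linear form
   u^T x is distributed as N(u^T mu, u^T Sigma u).  The second argument of normal_prob is
   a standard deviation; u = 0 is left out because normal_prob _ 0 is not a
   Dirac mass. *)
Definition is_normal (nu : probability 'cV[R]_p R) (mu : 'cV[R]_p) Sigma :=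
  forall u, u != 0 -> forall B : set R, measurable B ->
    nu [set x | B (dot u x)] =
    normal_prob (dot u mu) (Num.sqrt (dot u (Sigma *m u))) B.

End linear_algebra.

Section classification.
Context {R : realType} {p K : nat}.
Implicit Types (mu : 'I_K -> 'cV[R]_p) (Sigma S : 'M[R]_p).

(* [T x i] means that x is assigned to class i; every rule below assigns x to at
   most one class, and a point assigned to no class is misclassified. *)
Definition rule := 'cV[R]_p -> 'I_K -> Prop.

(* nu i is the distribution of the observations from class i, and every class has
   prior probability 1/K.  Since the new observation is independent of the
   sample, P(. | X) is obtained by evaluating at T := T_X, the rule built from
   the observed value of the sample. *)
Definition misclassification_rate (nu : 'I_K -> probability 'cV[R]_p R)
    (T : rule) : R :=
  \sum_(i < K) K%:R^-1 * fine (nu i [set x | ~ T x i]).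

Definition opt_rule mu Sigma : rule := fun x i =>
  forall j, j != i -> mahalanobis2 Sigma x (mu i) < mahalanobis2 Sigma x (mu j).

(* Pair-indexed vectors: [ah j i] is \hat a_{ji}. *)
Definition linear_rule S (ah bh : 'I_K -> 'I_K -> 'cV[R]_p) : rule := fun x i =>
  forall j, j != i -> dot (ah j i) (S *m (x - bh j i)) < 0.

Definition avec mu S (j i : 'I_K) : 'cV[R]_p := S *m (mu j - mu i).

Definition bvec mu (j i : 'I_K) : 'cV[R]_p := 2^-1 *: (mu j + mu i).

Definition dcoef mu S (a b : 'I_K -> 'I_K -> 'cV[R]_p) (j i : 'I_K) : R :=
  dot (a j i) (S *m (b j i - mu i)).

(* The squared distances are nonnegative, so the default 0 is harmless. *)
Definition Mmax mu Sigma : R :=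
  \big[Num.max/0]_(i < K) \big[Num.max/0]_(j < K | j != i)
    mahalanobis2 Sigma (mu j) (mu i).

End classification.

Arguments rule R p K : clear implicits.

(* A sample with m i observations of class i; [x (Tagged _ j)] with tag i is
   the observation x_{ij}. *)
Definition sample (R : realType) (p K : nat) (m : 'I_K -> nat) :=
  {i : 'I_K & 'I_(m i)} -> 'cV[R]_p.

Section random.
Context {R : realType}.

(* Taking some of the B k to be setT gives the product rule for subfamilies. *)
Definition mutually_independent d (T : measurableType d) (P : probability T R)
    d' (V : measurableType d') (I : finType) (X : I -> {RV P >-> V}) :=
  forall B : I -> set V, (forall k, measurable (B k)) ->
    P [set w | forall k, B k (X k w)] =
    (\prod_(k : I) fine (P (X k @^-1` B k)))%:E.

Section Op.
Context (d : nat -> measure_display) (T : forall n, measurableType (d n)).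
Variable P : forall n, probability (T n) R.

(* xi_n = O_p(r_n).  The bound is asked for all large n only: r_n may vanish for
   small n, for instance when it contains the square root of a negative
   number. *)
Definition is_Op (xi : forall n, T n -> R) (r : nat -> R) :=
  forall e : R, 0 < e -> exists C : R, \forall n \near \oo,
    (P n [set w | (C * r n < `|xi n w|)%R] <= e%:E)%E.

(* xi_{n,ji} = f_{n,ji} O_p(r_n) uniformly in j != i, that is,
   max_{j != i} |xi_{n,ji}| / (f_{n,ji} r_n) is bounded in probability, for
   nonnegative f; written without division since f may vanish at some w. *)
Definition is_Op_unif (K : nat -> nat)
    (xi f : forall n, 'I_(K n) -> 'I_(K n) -> T n -> R) (r : nat -> R) :=
  forall e : R, 0 < e -> exists C : R, \forall n \near \oo,
    (P n [set w | exists j i, j != i /\ (C * r n * f n j i w < `|xi n j i w|)%R]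
      <= e%:E)%E.

End Op.
End random.

(* Main.v *)
(* Fix a class i and j <> i, and put z = S (x - mu_i), U = a_ji^T z,
   V = (a_ji)_perp^T z, d = |a_ji|^2 / 2 and theta = sqrt (Mmax s).  When the three
   O_p bounds hold, the points on which the two rules disagree about the pair
   (j, i) satisfy |U - d| <= k theta + |V|, where Var V <= k theta^2.  The
   indicator of this set is at most a constant times
     e^(-d/2) sum_(+-) e^(U/2 +- 3 V/theta) / (1 + ((U - m_(+-)) / theta)^2),
   with m_(+-) the mean of U after the exponential change of measure.  The tilted
   variable U is still normal with variance |a_ji|^2, so the kernel integrates to
   O(theta / |a_ji|), and the disagreement has probability
   O(theta) e^(-|a_ji|^2/8) / |a_ji| = O(theta) P(U >= d).  Summing over j bounds
   the relative error by O(K theta), and log(1 / (Mmax s)) >= 1 eventually.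

   [is_normal] only gives the laws of single linear forms, and the Cramer-Wold
   theorem is avoided as follows: moment generating functions of all linear forms
   are known, hence so is E[e^W e^(h U)] for every linear form W and real h; a
   power series argument turns it into E[e^W cos (xi U)], which is all that the
   integral of the kernel needs. *)

Require Import Defs.
From HB Require Import structures.
From mathcomp Require Import all_boot all_order all_algebra.
From mathcomp Require Import all_classical all_reals all_analysis.
From mathcomp Require Import measurable_realfun ring lra.

Set Implicit Arguments.
Unset Strict Implicit.
Unset Printing Implicit Defensive.

Import Order.TTheory GRing.Theory Num.Theory.
Import numFieldNormedType.Exports.

Local Open Scope classical_set_scope.
Local Open Scope ring_scope.

(** * From moment generating functions to cosine transforms *)

(** Strong induction on [k]: once the earlier coefficients vanish, dividing by [y ^+ k] leaves
    [|e k| <= y * B] for every [y] in (0, 1], and [y] can be taken small. *)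
Lemma series_eq0_coef (R : realType) (e : R^nat) (B : R) :
  (forall n, \sum_(i < n) `|e i| <= B) ->
  (forall y, 0 < y <= 1 ->
     (\sum_(i < n) e i * y ^+ i) @[n --> \oo] --> (0 : R)) ->
  forall k, e k = 0.
Proof.
move=> eB e0 k; elim/ltn_ind: k => k IH.
have B0 : 0 <= B by have := eB 0%N; rewrite big_ord0.
have key y : 0 < y <= 1 -> `|e k| <= y * B.
  move=> y01; have /andP[y0 y1] := y01.
  (* The terms below [k] vanish by induction; those above [k] carry at least [y ^+ k.+1], because
     [y <= 1]. *)
  have lb n : (k < n)%N ->
    `|e k| * y ^+ k - y ^+ k.+1 * B <= `|\sum_(i < n) e i * y ^+ i|.
    move=> kn.
    rewrite (bigID (fun i : 'I_n => (i < k)%N))/= big1 ?add0r; last first.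
      by move=> i ik; rewrite IH// mul0r.
    rewrite (bigD1 (Ordinal kn))/= ?ltnn//.
    set s := \sum_(i < n | _) _.
    have -> : `|e k| * y ^+ k = `|e k * y ^+ k|.
      by rewrite normrM (ger0_norm (exprn_ge0 _ (ltW y0))).
    suff : `|s| <= y ^+ k.+1 * B.
      have := ler_normD (e k * y ^+ k + s) (- s).
      by rewrite addrK normrN; lra.
    apply: le_trans (ler_norm_sum _ _ _) _.
    apply: le_trans (_ : \sum_(i < n) y ^+ k.+1 * `|e i| <= _); last first.
      by rewrite -mulr_sumr ler_pM2l ?exprn_gt0.
    rewrite [leRHS](bigID (fun i : 'I_n => ~~ (i < k)%N && (i != Ordinal kn)))/=.
    rewrite -[leLHS]addr0 lerD//; last first.
      by apply: sumr_ge0 => i _; rewrite mulr_ge0// exprn_ge0 ?ltW.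
    apply: ler_sum => i /andP[ik ik']; rewrite normrM mulrC.
    rewrite ler_wpM2r// (ger0_norm (exprn_ge0 _ (ltW y0))).
    apply: ler_wiXn2l => //; first exact: ltW.
    by rewrite ltn_neqAle leqNgt ik andbT eq_sym.
  have : `|e k| * y ^+ k - y ^+ k.+1 * B <= `|(0:R)|.
    have cn : `|\sum_(i < n) e i * y ^+ i| @[n --> \oo] --> `|0 : R|.
      by apply: cvg_norm; exact: e0.
    apply: (cvgr_to_ge cn).
    by exists k.+1 => // n /= kn; exact: lb.
  rewrite normr0 subr_le0 exprS (mulrC y) -mulrA (mulrC `|_|).
  by rewrite ler_pM2l ?exprn_gt0.
have [->//|ek0] := eqVneq (e k) 0.
have ep : 0 < `|e k| by rewrite normr_gt0.
have D0 : 0 < `|e k| + B + 1 by lra.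
(* This [y] turns the bound into [|e k| + B + 1 <= B] when [e k] is nonzero, which is absurd. *)
have := key (`|e k| / (`|e k| + B + 1)).
rewrite divr_gt0//= ler_pdivrMr// mul1r => /(_ ltac:(lra)).
by rewrite mulrAC ler_pdivlMr//; nra.
Qed.

Lemma sum_le_cvg (R : realType) (u : R^nat) (l : R) :
  (forall k, 0 <= u k) -> (\sum_(i < n) u i) @[n --> \oo] --> l ->
  forall n, \sum_(i < n) u i <= l.
Proof.
move=> u0 ul n.
have ud : nondecreasing_seq (fun n : nat => \sum_(i < n) u i).
  move=> a b ab; rewrite -!(big_mkord xpredT u).
  by rewrite (big_cat_nat (leq0n a) ab)/= lerDl sumr_ge0.
rewrite -(cvg_lim _ ul)//.
by apply: (nondecreasing_cvgn_le ud); apply/cvg_ex; exists l.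
Qed.

Lemma cvg_sum_expR (R : realType) (x : R) :
  (\sum_(i < n) x ^+ i / i`!%:R) @[n --> \oo] --> expR x.
Proof.
have : cvgn (series (exp_coeff x)) by exact: is_cvg_series_exp_coeff.
by under [X in _ -> X]eq_cvg do rewrite -(big_mkord xpredT (exp_coeff x)).
Qed.

(** Add the exponential series at [x] and [- x] and group the terms in consecutive pairs: the odd
    ones cancel and the even ones double. *)
Lemma cvg_sum_cosh (R : realType) (x : R) :
  (\sum_(i < n) x ^+ i.*2 / i.*2`!%:R) @[n --> \oo] -->
  (expR x + expR (- x)) / 2.
Proof.
pose f i : R := (x ^+ i + (- x) ^+ i) / i`!%:R.
have fE : series f = series (exp_coeff x) + series (exp_coeff (- x)).
  apply/funext => n; rewrite /series/= fctE -big_split/=.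
  by apply: eq_bigr => i _; rewrite /f mulrDl.
have cf : series f @ \oo --> expR x + expR (- x).
  by rewrite fE; apply: cvgD; exact: is_cvg_series_exp_coeff.
have /cvg_series_cvg_series_group : cvgn (series f).
  by apply/cvg_ex; eexists; exact: cf.
move=> /(_ 2 isT); rewrite (cvg_lim _ cf)// => c2.
have -> : (fun n : nat => \sum_(i < n) x ^+ i.*2 / i.*2`!%:R) =
    (fun n => [series \sum_(n * 2 <= i < n.+1 * 2) f i]_n n / 2).
  apply/funext => n; rewrite /series/= big_mkord big_distrl/=.
  apply: eq_bigr => i _; rewrite !muln2 doubleS big_nat_recl//.
  have s2 : (-1) ^+ i.*2 = 1 :> R by rewrite -signr_odd odd_double.
  rewrite big_nat1 /f !(exprNn x) [(-1) ^+ _.+1]exprS s2 mulr1 mulN1r addrN.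
  by rewrite mul0r addr0 mul1r -mulr2n -mulr_natr; field;
    rewrite pnatr_eq0 -lt0n fact_gt0.
by apply: cvgM c2 _; exact: cvg_cst.
Qed.

(* With h replaced by [i xi] this is the identity of characteristic functions.
   Both sides of the hypothesis are power series in [h ^+ 2], so the even moments
   of X under [g mu] are determined, and then so is the cosine series. *)
Lemma cos_transform_of_mgf d (T : measurableType d) (R : realType)
    (mu : {measure set T -> \bar R}) (g X : T -> R) (A v : R) :
  measurable_fun setT g -> measurable_fun setT X -> (forall x, 0 <= g x) ->
  0 <= v ->
  (forall h, \int[mu]_x (g x * expR (h * X x))%:E =
             (A * expR (h ^+ 2 * v / 2))%:E)%E ->
  forall xi, (\int[mu]_x (g x * cos (xi * X x))%:E =
             (A * expR (- (xi ^+ 2 * v / 2)))%:E)%E.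
Proof.
move=> mg mX g0 v0 mgf xi.
have A0 : 0 <= A.
  have := mgf 0; rewrite expr0n/= !mul0r expR0 mulr1 => AE.
  by rewrite -lee_fin -AE; apply: integral_ge0 => x _;
    rewrite lee_fin mulr_ge0// expR_ge0.
have mgfint h : mu.-integrable setT (fun x => (g x * expR (h * X x))%:E).
  apply/integrableP; split.
    apply/measurable_EFinP; apply: measurable_funM => //.
    by apply: measurableT_comp => //; apply: measurable_funM.
  under eq_integral => x _ do rewrite gee0_abs ?lee_fin ?mulr_ge0 ?expR_ge0//.
  by rewrite mgf ltry.
(* Even moments of [X] under the density [g], divided by the factorial, so that they are the
   coefficients of a power series in [r ^+ 2]. *)
pose M k := (\int[mu]_x (g x * (X x ^+ k.*2 / k.*2`!%:R))%:E)%E.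
have mM k : measurable_fun setT (fun x => (g x * (X x ^+ k.*2 / k.*2`!%:R))%:E).
  apply/measurable_EFinP; apply: measurable_funM => //.
  by apply: measurable_funM => //; exact: measurable_funX.
have pM k x : 0 <= g x * (X x ^+ k.*2 / k.*2`!%:R).
  by rewrite mulr_ge0// divr_ge0// exprn_even_ge0 ?odd_double.
have coshE h : (\int[mu]_x (g x * ((expR (h * X x) + expR (- (h * X x))) / 2))%:E
    = (A * expR (h ^+ 2 * v / 2))%:E)%E.
  transitivity (\int[mu]_x ((2^-1)%:E *
      ((g x * expR (h * X x))%:E + (g x * expR (- h * X x))%:E)))%E.
    by apply: eq_integral => x _; rewrite -EFinD -EFinM mulNr; congr EFin; field.
  rewrite integralZl//; last by apply: integrableD => //; exact: mgfint.
  rewrite integralD//; try exact: mgfint.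
  by rewrite !mgf sqrrN -EFinD -EFinM; congr EFin; field.
(* Only the hyperbolic cosine is expanded: all its terms are nonnegative, so sum and integral can be
   exchanged without an integrability condition. *)
have sumM r : ((\sum_(k <oo) ((r ^+ 2) ^+ k)%:E * M k) =
    (A * expR (r ^+ 2 * v / 2))%:E)%E.
  rewrite -coshE.
  have ZM k : (((r ^+ 2) ^+ k)%:E * M k =
      \int[mu]_x (((r ^+ 2) ^+ k)%:E * (g x * (X x ^+ k.*2 / k.*2`!%:R))%:E))%E.
    rewrite /M ge0_integralZl_EFin//.
      by move=> x _; rewrite lee_fin.
    by rewrite exprn_ge0// sqr_ge0.
  transitivity (\sum_(k <oo) \int[mu]_x
      (((r ^+ 2) ^+ k)%:E * (g x * (X x ^+ k.*2 / k.*2`!%:R))%:E))%E.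
    by apply: eq_eseriesr => k _; exact: ZM.
  rewrite -integral_nneseries//; last 2 first.
  - by move=> n; apply: measurable_funeM.
  - by move=> n x _; rewrite -EFinM lee_fin mulr_ge0// exprn_ge0// sqr_ge0.
  apply: eq_integral => x _.
  apply: cvg_lim => //.
  rewrite (_ : (fun n => _) =
     (fun n => (g x * \sum_(i < n) (r * X x) ^+ i.*2 / i.*2`!%:R)%:E)); last first.
    apply/funext => n; rewrite big_mkord mulr_sumr -sumEFin; apply: eq_bigr => i _.
    rewrite -EFinM; congr EFin.
    have -> : (r * X x) ^+ i.*2 = (r ^+ 2) ^+ i * X x ^+ i.*2.
      by rewrite exprMn -[in RHS]exprM mul2n.
    by ring.
  apply: cvg_EFin; first by near=> n.
  by apply: cvgM; [exact: cvg_cst|exact: cvg_sum_cosh].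
have M0 k : (0 <= M k)%E by apply: integral_ge0 => x _; rewrite lee_fin.
(* At [r = 1] the series has nonnegative terms and a finite sum, so each term is finite. *)
have Mfin k : M k \is a fin_num.
  rewrite ge0_fin_numE//; apply: le_lt_trans (ltry (A * expR (1 ^+ 2 * v / 2))).
  rewrite -sumM; under eq_eseriesr do rewrite !expr1n mul1e.
  apply: le_trans (nneseries_lim_ge k.+1 _) => //.
  by rewrite big_nat_recr//= leeDr// sume_ge0.
have Mint k : mu.-integrable setT (fun x => (g x * (X x ^+ k.*2 / k.*2`!%:R))%:E).
  apply/integrableP; split => //.
  under eq_integral => x _ do rewrite gee0_abs ?lee_fin//.
  by have := Mfin k; rewrite ge0_fin_numE.
pose m k := fine (M k).
have ME k : M k = (m k)%:E by rewrite /m fineK.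
have m0 k : 0 <= m k by rewrite fine_ge0.
pose c k := A * ((v / 2) ^+ k / k`!%:R).
have c0 k : 0 <= c k by rewrite mulr_ge0// divr_ge0// exprn_ge0// divr_ge0.
have cvgc y : (\sum_(i < n) c i * y ^+ i) @[n --> \oo] --> A * expR (y * v / 2).
  rewrite (_ : (fun n => _) =
     (fun n => A * \sum_(i < n) (y * v / 2) ^+ i / i`!%:R)); last first.
    apply/funext => n; rewrite mulr_sumr; apply: eq_bigr => i _.
    by rewrite /c -[y * v / 2]mulrA [in RHS]exprMn; ring.
  by apply: cvgM; [exact: cvg_cst|exact: cvg_sum_expR].
have cvgm y : 0 <= y ->
    (\sum_(i < n) m i * y ^+ i) @[n --> \oo] --> A * expR (y * v / 2).
  move=> y0.
  suff : (\sum_(i < n) m i * y ^+ i)%:E @[n --> \oo] --> (A * expR (y * v / 2))%:E.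
    by move/fine_cvgP => [].
  have := sumM (Num.sqrt y); rewrite sqr_sqrtr// => <-.
  rewrite (_ : (fun n => _) =
    (fun n => \sum_(0 <= k < n) (y ^+ k)%:E * M k)%E); last first.
    apply/funext => n; rewrite big_mkord -sumEFin; apply: eq_bigr => i _.
    by rewrite ME -EFinM mulrC.
  by apply: is_cvg_nneseries => k _ _; rewrite mule_ge0// lee_fin exprn_ge0.
(* Both families are nonnegative with sum [A * expR (v / 2)] at [y = 1]; this gives the absolute
   bound that [series_eq0_coef] requires. *)
have mc k : m k = c k.
  apply/eqP; rewrite -subr_eq0; apply/eqP.
  move: k; apply: (@series_eq0_coef _ _ (A * expR (v / 2) + A * expR (v / 2))).
    move=> n; apply: le_trans (_ : \sum_(i < n) (m i + c i) <= _).
      apply: ler_sum => i _; apply: le_trans (ler_normB _ _) _.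
      by rewrite !ger0_norm.
    rewrite big_split/= lerD//; apply: sum_le_cvg => //.
      have := cvgm 1 ler01; rewrite mul1r.
      by under eq_fun do under eq_bigr do rewrite expr1n mulr1.
    have := cvgc 1; rewrite mul1r.
    by under eq_fun do under eq_bigr do rewrite expr1n mulr1.
  move=> y /andP[y0 _].
  rewrite (_ : (fun n => _) =
    (fun n => \sum_(i < n) m i * y ^+ i - \sum_(i < n) c i * y ^+ i)); last first.
    by apply/funext => n; rewrite -sumrB; apply: eq_bigr => i _; rewrite mulrBl.
  have := cvgB (cvgm _ (ltW y0)) (cvgc y); rewrite subrr.
  by move/(_ eventually_filter).
(* Partial sums of the cosine series against [g]; the hyperbolic cosine [G] dominates them all. *)
pose f_ n x : \bar R :=
  (\sum_(i < n) (- xi ^+ 2) ^+ i * (g x * (X x ^+ i.*2 / i.*2`!%:R)))%:E.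
pose G x : \bar R := (g x * ((expR (xi * X x) + expR (- (xi * X x))) / 2))%:E.
have Gint : mu.-integrable setT G.
  have -> : G = (fun x => (2^-1)%:E *
      ((g x * expR (xi * X x))%:E + (g x * expR (- xi * X x))%:E))%E.
    by apply/funext => x; rewrite -EFinD -EFinM mulNr /G; congr EFin; field.
  by apply: integrableZl => //; apply: integrableD => //; exact: mgfint.
have [] := @dominated_convergence _ _ _ mu setT measurableT f_
    (fun x => (g x * cos (xi * X x))%:E) G.
- move=> n; apply/measurable_EFinP; apply: measurable_sum => i.
  apply: measurable_funM => //; apply/measurable_EFinP; exact: mM.
- apply/measurable_EFinP; apply: measurable_funM => //.
  apply: measurableT_comp; last exact: measurable_funM.
  by apply: continuous_measurable_fun; exact: continuous_cos.
- apply: aeW => x _.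
  apply: cvg_EFin; first by near=> n.
  rewrite [X in X @ _ --> _](_ : _ =
     (fun n => g x * series (cos_coeff' (xi * X x)) n)); last first.
    apply/funext => n; rewrite /= /series/= big_mkord mulr_sumr.
    apply: eq_bigr => i _; rewrite /cos_coeff' -exprnP.
    have -> : (xi * X x) ^+ i.*2 = xi ^+ i.*2 * X x ^+ i.*2 by rewrite exprMn.
    have -> : (- xi ^+ 2) ^+ i = (-1) ^+ i * xi ^+ i.*2.
      by rewrite (exprNn (xi ^+ 2)) -exprM mul2n.
    ring.
  by apply: cvgM; [exact: cvg_cst|exact: cvg_cos_coeff'].
- exact: Gint.
- apply: aeW => x n _; rewrite /f_ /G /= lee_fin.
  apply: le_trans (ler_norm_sum _ _ _) _.
  have pc k : 0 <= (xi * X x) ^+ k.*2 / k.*2`!%:R.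
    by rewrite divr_ge0// exprn_even_ge0// odd_double.
  apply: le_trans (ler_wpM2l (g0 x) (sum_le_cvg pc (@cvg_sum_cosh _ (xi * X x)) n)).
  rewrite mulr_sumr; apply: ler_sum => i _.
  rewrite normrM (ger0_norm (pM _ _)) normrX normrN ger0_norm ?sqr_ge0//.
  have -> : (xi * X x) ^+ i.*2 = (xi ^+ 2) ^+ i * X x ^+ i.*2.
    by rewrite exprMn -[in RHS]exprM mul2n.
  by rewrite mulrCA !mulrA.
move=> _ _ cvf.
(* After integration these are partial sums of the series of the [c k] at [y = - xi ^+ 2]; [cvgc]
   allows a negative [y], [cvgm] does not. *)
have cvf' : (fun n => \int[mu]_x f_ n x)%E @ \oo -->
    (A * expR (- (xi ^+ 2 * v / 2)))%:E.
  rewrite (_ : (fun n => _) = (fun n => (\sum_(i < n) c i * (- xi ^+ 2) ^+ i)%:E)).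
    apply: cvg_EFin; first by near=> n.
    by have := cvgc (- xi ^+ 2); rewrite !mulNr.
  apply/funext => n; rewrite /f_.
  under eq_integral do rewrite -sumEFin.
  rewrite integral_sum//; last first.
    by move=> k; under eq_fun do rewrite EFinM; apply: integrableZl.
  rewrite -sumEFin; apply: eq_bigr => i _.
  under eq_integral do rewrite EFinM.
  rewrite integralZl//.
  by rewrite -/(M i) ME mc -EFinM mulrC.
exact: (cvg_unique _ cvf cvf').
Unshelve. all: by end_near.
Qed.

(** * A local bound for exponentially tilted measures *)

Lemma derive_laplace_kernel (R : realType) (y xi : R) :
  is_derive xi (1 : R)
    (fun z => expR (- z) * ((y * sin (z * y) - cos (z * y)) / (1 + y ^+ 2) - 1))
    (expR (- xi) * (1 + cos (xi * y))).
Proof.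
have D1 : is_derive xi (1 : R) (fun z => z * y : R) y.
  by apply: is_derive_eq; rewrite !scaler0 add0r scaler1.
have D2 : is_derive xi (1 : R) (fun z => - z : R) (-1).
  by apply: is_derive_eq.
have DE : is_derive xi (1 : R) (fun z => expR (- z)) (expR (- xi) * -1).
  exact: is_derive1_comp.
have DS : is_derive xi (1 : R) (fun z => sin (z * y)) (cos (xi * y) * y).
  exact: is_derive1_comp.
have DC : is_derive xi (1 : R) (fun z => cos (z * y)) (- sin (xi * y) * y).
  exact: is_derive1_comp.
have y1 : 1 + y ^+ 2 != 0 by rewrite gt_eqF// ltr_pwDl// sqr_ge0.
apply: is_derive_eq; rewrite !scaler0 !(addr0, add0r, subr0) /GRing.scale/=.
by field.
Qed.

(** The antiderivative [F] of [derive_laplace_kernel] is [expR (- z)] times a bounded factor, hence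
    vanishes at infinity, and the integral is [- F 0]. *)
Lemma laplace_cos_kernel (R : realType) (y : R) :
  (\int[lebesgue_measure]_(xi in `[(0:R)%R, +oo[)
     (expR (- xi) * (1 + cos (xi * y)))%:E =
   (1 + (1 + y ^+ 2)^-1)%:E)%E.
Proof.
pose F (z : R) := expR (- z) * ((y * sin (z * y) - cos (z * y)) / (1 + y ^+ 2) - 1).
have y1 : 1 + y ^+ 2 != 0 by rewrite gt_eqF// ltr_pwDl// sqr_ge0.
have dF z : derivable F z 1 by have := derive_laplace_kernel y z => -[].
have cF : continuous F.
  by move=> z; apply: differentiable_continuous; apply/derivable1_diffP.
rewrite (@ge0_continuous_FTC2y _ _ F 0 0) //.
- rewrite /F oppr0 expR0 mul1r !mul0r sin0 cos0 mulr0 sub0r -EFinB; congr EFin; field.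
  by rewrite y1.
- apply: continuous_subspaceT => x.
  have c1 : {for x, continuous (fun x : R => x * y)}.
    by apply: cvgM; [exact: cvg_id|exact: cvg_cst].
  apply: cvgM.
    apply: continuous_comp; last exact: continuous_expR.
    exact: opp_continuous.
  apply: cvgD; first exact: cvg_cst.
  by apply: (continuous_comp c1); exact: continuous_cos.
- pose B := `|y| + 2.
  have hB x : `|(y * sin (x * y) - cos (x * y)) / (1 + y ^+ 2) - 1| <= B.
    apply: le_trans (ler_normB _ _) _; rewrite normr1 /B -[2]/(1 + 1) addrA lerD2r.
    rewrite normrM normfV; apply: le_trans (_ : `|y * sin (x * y) - cos (x * y)| <= _).
      rewrite ler_piMr// invf_le1 ?normr_gt0//.
      by rewrite ger0_norm ?lerDl ?sqr_ge0// addr_ge0// sqr_ge0.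
    apply: le_trans (ler_normB _ _) _; rewrite normrM lerD ?cos_max//.
    by rewrite ler_piMr// sin_max.
  have cB : B * expR (- x) @[x --> +oo%R] --> (0 : R).
    by rewrite -(mulr0 B); apply: cvgM; [exact: cvg_cst|exact: cvgr_expR].
  apply: (squeeze_cvgr _ (_ : - (B * expR (- x)) @[x --> +oo%R] --> (0 : R)) cB).
    apply: nearW => x; rewrite -ler_norml /F normrM (ger0_norm (expR_ge0 _)).
    by rewrite mulrC ler_wpM2r// expR_ge0.
  by rewrite -oppr0; exact: cvgN.
- by apply: cvg_at_right_filter; exact: cF.
- by move=> x _; rewrite derive1E; have [_ ->] := derive_laplace_kernel y x.
Qed.

Lemma measurable_cauchy_kernel (R : realType) :
  measurable_fun setT (fun y : R => (1 + y ^+ 2)^-1).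
Proof.
apply: continuous_measurable_fun => y; apply: cvgV.
  by rewrite gt_eqF// ltr_pwDl// sqr_ge0.
by apply: cvgD; [exact: cvg_cst|exact: sqr_continuous].
Qed.

(* The kernel [1 / (1 + X ^+ 2)] is the Laplace transform of [cos (xi * X)]; the
   constant 1 added to the cosine in the proof makes Tonelli applicable. *)
Lemma cauchy_kernel_bound d (T : measurableType d) (R : realType)
    (mu : {sigma_finite_measure set T -> \bar R}) (g X : T -> R) (A v : R) :
  measurable_fun setT g -> measurable_fun setT X -> (forall x, 0 <= g x) ->
  0 < v ->
  (forall h, \int[mu]_x (g x * expR (h * X x))%:E =
             (A * expR (h ^+ 2 * v / 2))%:E)%E ->
  (\int[mu]_x (g x * (1 + X x ^+ 2)^-1)%:E <=
   (A * Num.sqrt (2 * pi / v))%:E)%E.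
Proof.
move=> mg mX g0 v0 mgf.
have mg' : (\int[mu]_x (g x)%:E = A%:E)%E.
  have := mgf 0; rewrite expr0n/= !mul0r expR0 mulr1 => <-.
  by apply: eq_integral => x _; rewrite mul0r expR0 mulr1.
have A0 : 0 <= A by rewrite -lee_fin -mg'; apply: integral_ge0 => x _; rewrite lee_fin.
have gint : mu.-integrable setT (EFin \o g).
  apply/integrableP; split; first exact/measurable_EFinP.
  under eq_integral => x _ do rewrite gee0_abs ?lee_fin//.
  by rewrite mg' ltry.
have gcosint xi : mu.-integrable setT (fun x => (g x * cos (xi * X x))%:E).
  apply: le_integrable gint => //.
    apply/measurable_EFinP; apply: measurable_funM => //.
    apply: measurableT_comp; last exact: measurable_funM.
    by apply: continuous_measurable_fun; exact: continuous_cos.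
  move=> x _ /=; rewrite lee_fin normrM ler_piMr//; exact: cos_max.
(* The joint integrand, integrated over [z.2] in the half-line by [inner] and over [z.1] by [outer];
   [f] extends it by zero to negative [z.2]. *)
pose q (z : T * R) := g z.1 * (expR (- z.2) * (1 + cos (z.2 * X z.1))).
have q0 z : 0 <= q z.
  by rewrite mulr_ge0// mulr_ge0 ?expR_ge0//; have := cos_geN1 (z.2 * X z.1); lra.
have mq : measurable_fun setT q.
  apply: measurable_funM; first exact: measurableT_comp.
  apply: measurable_funM.
    by do 2 apply: measurableT_comp => //.
  apply: measurable_funD => //.
  apply: measurableT_comp.
    by apply: continuous_measurable_fun; exact: continuous_cos.
  by apply: measurable_funM => //; exact: measurableT_comp.
pose f (z : T * R) : \bar R := (q z * \1_(`[(0:R), +oo[%classic : set R) z.2)%:E.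
have f0 z : (0 <= f z)%E by rewrite lee_fin mulr_ge0.
have mf : measurable_fun setT f.
  apply/measurable_EFinP; apply: measurable_funM => //.
  by apply: measurableT_comp => //; exact: measurable_indic.
have inner x : (\int[lebesgue_measure]_xi f (x, xi) =
    (g x * (1 + (1 + X x ^+ 2)^-1))%:E)%E.
  rewrite [RHS]EFinM -laplace_cos_kernel -ge0_integralZl_EFin//; last first.
    apply: measurable_funTS; apply/measurable_EFinP; apply: measurable_funM.
      by apply: measurableT_comp.
    apply: measurable_funD => //.
    apply: measurableT_comp; last exact: measurable_funM.
    by apply: continuous_measurable_fun; exact: continuous_cos.
  rewrite [RHS]integral_mkcond; apply: eq_integral => xi _.
  rewrite /f /q patchE indicE /=.
  by case: ifPn => _; rewrite ?(mulr1, mulr0) ?EFinM.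
have outer xi : 0 <= xi -> (\int[mu]_x (q (x, xi))%:E =
    (expR (- xi) * (A + A * expR (- (xi ^+ 2 * v / 2))))%:E)%E.
  move=> xi0.
  transitivity (\int[mu]_x ((expR (- xi))%:E *
    ((g x)%:E + (g x * cos (xi * X x))%:E)))%E.
    by apply: eq_integral => x _; rewrite -EFinD -EFinM /q/=; congr EFin; ring.
  rewrite integralZl//; last exact: integrableD.
  rewrite integralD// mg' (cos_transform_of_mgf mg mX g0 (ltW v0) mgf).
  by rewrite -EFinD -EFinM.
(* The result of [outer] is majorized by multiples of two probability densities, whose integrals
   over the line are known. In the Gaussian term the factor [expR (- xi)] is bounded by 1. *)
pose h1 (xi : R) := exponential_pdf 1 xi.
pose w := Num.sqrt (2 * pi / v).
have w0 : 0 < w by rewrite sqrtr_gt0 divr_gt0// mulr_gt0// pi_gt0.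
pose h2 (xi : R) := w * normal_pdf 0 (Num.sqrt v)^-1 xi.
have sv0 : (Num.sqrt v)^-1 != 0 by rewrite invr_neq0// gt_eqF// sqrtr_gt0.
have h2E xi : h2 xi = expR (- (xi ^+ 2 * v / 2)).
  rewrite /h2 normal_pdfE// /normal_peak /normal_fun exprVn sqr_sqrtr ?(ltW v0)//.
  have -> : v^-1 * pi *+ 2 = 2 * pi / v by rewrite -mulr_natr; ring.
  rewrite mulrA divff ?gt_eqF// mul1r subr0; congr expR.
  by rewrite -mulr_natr; field; rewrite gt_eqF.
have h10 xi : 0 <= h1 xi by exact: exponential_pdf_ge0.
have h20 xi : 0 <= h2 xi by rewrite h2E expR_ge0.
have mh1 : measurable_fun setT h1 by exact: measurable_exponential_pdf.
have mh2 : measurable_fun setT h2.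
  by apply: measurable_funM => //; exact: measurable_normal_pdf.
have main : (\int[mu]_x (g x * (1 + (1 + X x ^+ 2)^-1))%:E <= (A + A * w)%:E)%E.
  under eq_integral do rewrite -inner.
  rewrite (fubini_tonelli (m1 := mu) (m2 := lebesgue_measure) f)//.
  apply: (@le_trans _ _ (\int[lebesgue_measure]_xi
    (A%:E * ((h1 xi)%:E + (h2 xi)%:E)))%E).
    apply: ge0_le_integral => //.
    - by move=> xi _; apply: integral_ge0.
    - exact: measurable_fun_fubini_tonelli_G.
    - apply: measurable_funeM; apply: emeasurable_funD; exact/measurable_EFinP.
    - move=> xi _; have [xi0|xi0] := leP 0 xi.
        rewrite /f; under eq_integral do
          rewrite indicE mem_set/= ?in_itv/= ?xi0// mulr1.
        rewrite outer// -EFinD -EFinM lee_fin /h1 exponential_pdfE// h2E.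
        rewrite mulrDr [leRHS]mulrDr lerD//.
          by rewrite mul1r mulN1r mulrC.
        by rewrite ler_piMl ?mulr_ge0 ?expR_ge0// expR_le1 oppr_le0.
      rewrite /f; under eq_integral do
        rewrite indicE memNset/= ?in_itv/= ?leNgt ?xi0// mulr0.
      by rewrite integral0 -EFinD -EFinM lee_fin mulr_ge0// addr_ge0.
  rewrite ge0_integralZl_EFin//; last 2 first.
  - by move=> xi _; rewrite -EFinD lee_fin addr_ge0.
  - by apply: emeasurable_funD; exact/measurable_EFinP.
  rewrite ge0_integralD//; try exact/measurable_EFinP;
    try by move=> xi _; rewrite lee_fin.
  rewrite integral_exponential_pdf//.
  under eq_integral do rewrite EFinM.
  rewrite ge0_integralZl_EFin ?(ltW w0)//;
    try by [apply/measurable_EFinP; exact: measurable_normal_pdf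
           |move=> xi _; rewrite lee_fin normal_pdf_ge0].
  by rewrite integral_normal_pdf mule1 -EFinD -EFinM mulrDr mulr1.
(* The constant 1 added to the kernel contributes exactly [A] to both sides and cancels. *)
move: main.
under eq_integral do rewrite mulrDr mulr1 EFinD.
rewrite ge0_integralD//; try exact/measurable_EFinP; last 3 first.
- by move=> x _; rewrite lee_fin.
- by move=> x _; rewrite lee_fin mulr_ge0// invr_ge0 addr_ge0// sqr_ge0.
- apply/measurable_EFinP; apply: measurable_funM => //.
  apply: (measurableT_comp (f := fun y : R => (1 + y ^+ 2)^-1)) => //.
  exact: measurable_cauchy_kernel.
by rewrite mg' EFinD leeD2lE.
Qed.

(** * Standardized normal vectors *)

Lemma ge0_integral_law d1 d2 (T1 : measurableType d1) (T2 : measurableType d2)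
    (R : realType) (m1 : {measure set T1 -> \bar R})
    (m2 : {measure set T2 -> \bar R}) (X : T1 -> T2) (f : T2 -> \bar R) :
  measurable_fun setT X ->
  (forall B, measurable B -> m1 (X @^-1` B) = m2 B) ->
  measurable_fun setT f -> (forall y, 0 <= f y)%E ->
  (\int[m1]_x f (X x) = \int[m2]_y f y)%E.
Proof.
move=> mX law mf f0.
pose X' : {mfun T1 >-> T2} := HB.pack X (isMeasurableFun.Build _ _ _ _ X mX).
transitivity (\int[pushforward m1 X']_y f y)%E.
  by rewrite ge0_integral_pushforward.
by apply: eq_measure_integral => B mB _; exact: law.
Qed.

(** The Radon-Nikodym derivative of [normal_prob m s] and the function [normal_pdf m s] have the
    same integral over every measurable set, so they agree almost everywhere. *)
Lemma ge0_integral_normal_prob (R : realType) (m s : R) (f : R -> \bar R) :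
  measurable_fun setT f -> (forall x, 0 <= f x)%E ->
  (\int[normal_prob m s]_x f x =
   \int[lebesgue_measure]_x (f x * (normal_pdf m s x)%:E))%E.
Proof.
move=> mf f0.
have dom := @normal_prob_dominates R m s.
rewrite -(Radon_Nikodym_SigmaFinite.change_of_variables dom)//.
have mRN : measurable_fun setT
    (Radon_Nikodym_SigmaFinite.f (normal_prob m s) (@lebesgue_measure R)).
  exact: measurable_int (Radon_Nikodym_SigmaFinite.f_integrable dom).
have mpdf : measurable_fun setT (fun x : R => (normal_pdf m s x)%:E).
  by apply/measurable_EFinP; exact: measurable_normal_pdf.
apply: ae_eq_integral => //.
- exact: emeasurable_funM.
- exact: emeasurable_funM.
- apply: ae_eqe_mul2l; apply: integral_ae_eq => //.
    exact: Radon_Nikodym_SigmaFinite.f_integrable.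
  by move=> E _ mE; rewrite -Radon_Nikodym_SigmaFinite.f_integral.
Qed.

(** Completing the square: tilting by [expR x] moves the mean by the variance. *)
Lemma normal_pdf_tilt (R : realType) (m s x : R) : s != 0 ->
  expR x * normal_pdf m s x =
  expR (m + s ^+ 2 / 2) * normal_pdf (m + s ^+ 2) s x.
Proof.
move=> s0; rewrite !normal_pdfE// /normal_fun mulrCA [RHS]mulrCA -!expRD.
by congr (_ * expR _); rewrite -mulr_natr; field.
Qed.

Lemma mgf_normal_prob (R : realType) (m s : R) : s != 0 ->
  (\int[normal_prob m s]_x (expR x)%:E = (expR (m + s ^+ 2 / 2))%:E)%E.
Proof.
move=> s0; rewrite ge0_integral_normal_prob//; last first.
  by apply/measurable_EFinP.
under eq_integral do rewrite -EFinM normal_pdf_tilt// EFinM.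
rewrite ge0_integralZl_EFin ?expR_ge0//.
- by rewrite integral_normal_pdf mule1.
- by move=> x _; rewrite lee_fin normal_pdf_ge0.
- by apply/measurable_EFinP; exact: measurable_normal_pdf.
Qed.

(** Keep only the unit interval that starts at the threshold, and bound the density there by its
    value at the right end, where the exponent is [- (s ^+ 2 / 2 + 1) ^+ 2 / (2 * s ^+ 2)]. *)
Lemma normal_prob_tail_ge (R : realType) (m s : R) : 0 < s ->
  ((normal_peak s * expR (- (s ^+ 2 / 8 + 1 / 2 + 1 / (2 * s ^+ 2))))%:E <=
   normal_prob m s `[(m + s ^+ 2 / 2)%R, +oo[)%E.
Proof.
move=> s0; set c := normal_peak s * _.
have s0' : s != 0 by rewrite gt_eqF.
pose I := `[m + s ^+ 2 / 2, m + s ^+ 2 / 2 + 1]%classic.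
apply: (@le_trans _ _ (normal_prob m s I)); last first.
  apply: le_measure; [by rewrite inE; exact: measurable_itv..|].
  by move=> x; rewrite /I/= !in_itv/= andbT => /andP[].
rewrite /normal_prob.
apply: (@le_trans _ _ (\int[lebesgue_measure]_(x in I) (cst c%:E x))%E).
  rewrite integral_cst /I//= lebesgue_measure_itv/= lte_fin ltrDl ltr01.
  by rewrite -EFinD addrAC subrr add0r mule1.
apply: ge0_le_integral => //.
- exact: measurable_itv.
- by move=> x _; rewrite lee_fin /c mulr_ge0 ?expR_ge0// normal_peak_ge0.
- by apply/measurable_EFinP/measurable_funTS; exact: measurable_normal_pdf.
- move=> x; rewrite /I/= in_itv/= => /andP[x1 x2].
  rewrite lee_fin normal_pdfE// /c /normal_fun ler_wpM2l ?normal_peak_ge0//.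
  rewrite ler_expR mulNr lerN2 -mulr_natr ler_pdivrMr ?mulr_gt0 ?exprn_gt0//.
  have -> : (s ^+ 2 / 8 + 1 / 2 + 1 / (2 * s ^+ 2)) * (s ^+ 2 * 2) =
      (s ^+ 2 / 2 + 1) ^+ 2.
    by field.
  have s2 : 0 < s ^+ 2 by rewrite exprn_gt0.
  by rewrite ler_sqr ?nnegrE; lra.
Qed.

Section normal_vectors.
Context {R : realType} {p : nat}.
Implicit Types (u v w x : 'cV[R]_p) (A S Sigma : 'M[R]_p).

Lemma dotE u v : dot u v = \sum_k u k 0 * v k 0.
Proof. by rewrite /dot mxE; apply: eq_bigr => k _; rewrite mxE. Qed.

Lemma dotC u v : dot u v = dot v u.
Proof. by rewrite !dotE; apply: eq_bigr => k _; rewrite mulrC. Qed.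

Lemma dotDr u v w : dot u (v + w) = dot u v + dot u w.
Proof. by rewrite /dot mulmxDr mxE. Qed.

Lemma dotDl u v w : dot (u + v) w = dot u w + dot v w.
Proof. by rewrite !(dotC _ w) dotDr. Qed.

Lemma dotZr k u v : dot u (k *: v) = k * dot u v.
Proof. by rewrite /dot -scalemxAr mxE. Qed.

Lemma dotZl k u v : dot (k *: u) v = k * dot u v.
Proof. by rewrite !(dotC _ v) dotZr. Qed.

Lemma dotNr u v : dot u (- v) = - dot u v.
Proof. by rewrite -scaleN1r dotZr mulN1r. Qed.

Lemma dotNl u v : dot (- u) v = - dot u v.
Proof. by rewrite !(dotC _ v) dotNr. Qed.

Lemma dot_mulmx u A v : dot u (A *m v) = dot (A^T *m u) v.
Proof. by rewrite /dot trmx_mul trmxK mulmxA. Qed.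

Lemma sqnorm_ge0 u : 0 <= sqnorm u.
Proof. by rewrite /sqnorm dotE sumr_ge0// => k _; rewrite -expr2 sqr_ge0. Qed.

Lemma sqnorm_eq0 u : (sqnorm u == 0) = (u == 0).
Proof.
apply/idP/eqP => [|->]; last by rewrite /sqnorm dotE big1// => k _; rewrite mxE mul0r.
rewrite /sqnorm dotE psumr_eq0 => [/allP u0|k _]; last by rewrite -expr2 sqr_ge0.
apply/matrixP => k j; rewrite ord1 mxE.
have := u0 k; rewrite mem_index_enum => /(_ isT).
by rewrite -expr2 sqrf_eq0 => /eqP.
Qed.

Lemma sqnormD (u v : 'cV[R]_p) :
  sqnorm (u + v) = sqnorm u + 2 * dot u v + sqnorm v.
Proof. by rewrite /sqnorm dotDl !dotDr (dotC v u); ring. Qed.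

Lemma sqnormZ (k : R) (u : 'cV[R]_p) : sqnorm (k *: u) = k ^+ 2 * sqnorm u.
Proof. by rewrite /sqnorm dotZl dotZr; ring. Qed.

Lemma posdef_unitmx A : posdef A -> A \in unitmx.
Proof.
move=> [AT Apos]; rewrite unitmxE unitfE; apply/negP => /det0P[v v0 vA].
have := Apos v^T; rewrite trmx_eq0 v0 => /(_ isT).
by rewrite /dot trmxK mulmxA vA mul0mx mxE ltxx.
Qed.

Lemma inv_sqrt_sandwich Sigma S : posdef Sigma -> is_inv_sqrt Sigma S ->
  S *m Sigma *m S = 1%:M.
Proof.
move=> /posdef_unitmx Su [_ SS]; apply: mulmx1C.
by rewrite mulmxA SS mulVmx.
Qed.

Lemma measurable_coord (k : 'I_p) : measurable_fun setT (fun x => x k 0).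
Proof.
move=> _ Y mY; rewrite setTI; apply: sub_sigma_algebra => /=.
rewrite -bigcup_seq/=; exists k => /=; first by rewrite mem_index_enum.
by exists Y => //; rewrite setTI.
Qed.

Lemma measurable_dot u : measurable_fun setT (dot u).
Proof.
have -> : dot u = (fun x => \sum_k u k 0 * x k 0).
  by apply/funext => x; rewrite dotE.
apply: measurable_sum => k; apply: measurable_funM => //; exact: measurable_coord.
Qed.

Variables (mu : 'cV[R]_p) (Sigma S : 'M[R]_p) (nu : probability 'cV[R]_p R).
Hypotheses (Sigma_posdef : posdef Sigma) (S_inv : is_inv_sqrt Sigma S).
Hypothesis nu_normal : is_normal nu mu Sigma.

Lemma standardized_dot u x :
  dot u (S *m (x - mu)) = dot (S *m u) x - dot (S *m u) mu.
Proof. by rewrite dot_mulmx S_inv.1.1 dotDr dotNr. Qed.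

Lemma measurable_standardized_dot u :
  measurable_fun setT (fun x => dot u (S *m (x - mu))).
Proof.
under eq_fun do rewrite standardized_dot.
by apply: measurable_funB => //; exact: measurable_dot.
Qed.

(** The linear form [S *m u] has variance [|u|^2] by [inv_sqrt_sandwich], which also shows that this
    form is nonzero. *)
Lemma standardized_law u (B : set R) : u != 0 -> measurable B ->
  nu [set x | B (dot (S *m u) x)] =
  normal_prob (dot (S *m u) mu) (Num.sqrt (sqnorm u)) B.
Proof.
move=> u0 mB.
have SS := inv_sqrt_sandwich Sigma_posdef S_inv.
have Su0 : S *m u != 0.
  apply: contra_neq u0 => Su0.
  by rewrite -[u]mul1mx -SS -mulmxA Su0 mulmx0.
have -> : sqnorm u = dot (S *m u) (Sigma *m (S *m u)).
  by rewrite -{1}S_inv.1.1 -dot_mulmx !mulmxA SS mul1mx.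
exact: nu_normal Su0 B mB.
Qed.

Lemma mgf_standardized u :
  (\int[nu]_x (expR (dot u (S *m (x - mu))))%:E = (expR (sqnorm u / 2))%:E)%E.
Proof.
(* [is_normal] speaks of nonzero forms only; for [u = 0] both sides are 1. *)
have [->|u0] := eqVneq u 0.
  have d0 (w : 'cV[R]_p) : dot 0 w = 0.
    by rewrite dotE big1// => k _; rewrite mxE mul0r.
  under eq_integral do rewrite d0.
  by rewrite /sqnorm d0 mul0r expR0 integral_cst//= mul1e; exact: probability_setT.
have s0 : Num.sqrt (sqnorm u) != 0.
  by rewrite gt_eqF// sqrtr_gt0 lt_neqAle eq_sym sqnorm_eq0 u0 sqnorm_ge0.
have mS := measurable_dot (S *m u).
set c := dot (S *m u) mu.
under eq_integral do rewrite standardized_dot addrC expRD EFinM.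
rewrite ge0_integralZl_EFin ?expR_ge0//; last first.
  by apply/measurable_EFinP; exact: measurableT_comp.
have -> : (\int[nu]_x (expR (dot (S *m u) x))%:E = (expR (c + sqnorm u / 2))%:E)%E.
  transitivity (\int[normal_prob c (Num.sqrt (sqnorm u))]_y (expR y)%:E)%E.
    apply: (@ge0_integral_law _ _ _ _ _ nu (normal_prob c (Num.sqrt (sqnorm u)))
      (dot (S *m u)) (fun y : R => (expR y)%:E) mS).
    - by move=> B mB; exact: (standardized_law u0 mB).
    - exact/measurable_EFinP.
    - by move=> y; rewrite lee_fin expR_ge0.
  by rewrite mgf_normal_prob// sqr_sqrtr// sqnorm_ge0.
by rewrite -EFinM -expRD addrA addNr add0r.
Qed.

End normal_vectors.

(* The factor [expR (U / 2)] is the exponential change of measure that makes the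
   threshold d the mean of U; [expR (3 * V / th)] pays for the growth in V of the
   width of the window, and [e] recentres the kernel at the tilted mean of U. *)
Lemma tilted_cauchy_majorant_aux (R : realType) (U V d e k th : R) :
  0 < th <= 1 -> 0 <= k -> 0 <= V -> `|e| <= 3 * k * th ->
  `|U - d| <= k * th + V ->
  1 <= 2 * (1 + 4 * k) ^+ 2 * expR (k / 2) * expR (- d / 2) *
       (expR (U / 2 + 3 / th * V) * (1 + ((U - (d + e)) / th) ^+ 2)^-1).
Proof.
move=> /andP[th0 th1] k0 V0 he hU.
set v := V / th.
have v0 : 0 <= v by rewrite divr_ge0// ltW.
have VE : V = th * v by rewrite /v mulrC divfK// gt_eqF.
have Vv : V <= v by rewrite VE ler_piMl.
set X := (U - (d + e)) / th.
(* In units of [th], the window contributes [k + v] and the recentring [e] at most [3 * k]. *)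
have X2 : X ^+ 2 <= (4 * k + v) ^+ 2.
  rewrite -[X ^+ 2]real_normK ?num_real// ler_sqr ?nnegrE//; last by lra.
  rewrite /X normrM normfV (gtr0_norm th0) ler_pdivrMr//.
  rewrite opprD addrA; apply: le_trans (ler_normB _ _) _.
  by rewrite mulrDl (mulrC v) -VE; lra.
have D0 : 0 < 1 + X ^+ 2 by rewrite ltr_pwDl// sqr_ge0.
(* The polynomial growth in [v] is turned into an exponential by [1 + v <= expR v]. *)
have DB : 1 + X ^+ 2 <= 2 * (1 + 4 * k) ^+ 2 * expR (2 * v).
  apply: (@le_trans _ _ (2 * (1 + 4 * k) ^+ 2 * (1 + v) ^+ 2)).
    have h1 : 1 <= (1 + 4 * k) * (1 + v) by nra.
    have h2 : 4 * k + v <= (1 + 4 * k) * (1 + v) by nra.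
    have h3 : (4 * k + v) ^+ 2 <= ((1 + 4 * k) * (1 + v)) ^+ 2.
      by rewrite ler_sqr ?nnegrE//; nra.
    have h4 : 1 <= ((1 + 4 * k) * (1 + v)) ^+ 2 by rewrite expr_ge1//; lra.
    by rewrite -mulrA -exprMn; lra.
  apply: ler_wpM2l; first by rewrite mulr_ge0// sqr_ge0.
  rewrite (expRM_natl 2) ler_sqr ?nnegrE ?expR_ge0 ?expR_ge1Dx//.
  by lra.
rewrite mulrA ler_pdivlMr// mul1r.
apply: le_trans DB _.
have : 0 <= 2 * (1 + 4 * k) ^+ 2 by rewrite mulr_ge0// sqr_ge0.
move: (2 * (1 + 4 * k) ^+ 2) => c c0.
rewrite -!mulrA; apply: ler_wpM2l => //.
rewrite -!expRD ler_expR.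
have -> : 3 * (th^-1 * V) = 3 * v by rewrite VE; field; rewrite gt_eqF.
(* What remains is [2 * v <= k / 2 + (U - d) / 2 + 3 * v], and [U - d >= - k - v] on the window. *)
have := hU; rewrite ler_norml => /andP[hU1 _].
have kt : k * th <= k by rewrite ler_piMr.
lra.
Qed.

(** The sign of [V] selects the summand that gives the bound; the other one is nonnegative. In the
    application [r] is both the variance of [V] and its covariance with [U], so [3 / th * r] is the
    shift of the mean of [U] under the tilt in [V]. *)
Lemma tilted_cauchy_majorant (R : realType) (U V d r k th : R) :
  0 < th <= 1 -> 0 <= k -> 0 <= r <= k * th ^+ 2 ->
  `|U - d| <= k * th + `|V| ->
  1 <= 2 * (1 + 4 * k) ^+ 2 * expR (k / 2) * expR (- d / 2) *
   (expR (U / 2 + 3 / th * V) * (1 + ((U - (d + 3 / th * r)) / th) ^+ 2)^-1 +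
    expR (U / 2 - 3 / th * V) * (1 + ((U - (d - 3 / th * r)) / th) ^+ 2)^-1).
Proof.
move=> th01 k0 /andP[r0 rk] hU; have /andP[th0 th1] := th01.
have he : `|3 / th * r| <= 3 * k * th.
  rewrite ger0_norm; last by rewrite mulr_ge0// divr_ge0// ltW.
  by rewrite mulrAC ler_pdivrMr//; nra.
have T0 (x y : R) : 0 <= expR x * (1 + y ^+ 2)^-1.
  by rewrite mulr_ge0 ?expR_ge0// invr_ge0 addr_ge0// sqr_ge0.
have C0 : 0 <= 2 * (1 + 4 * k) ^+ 2 * expR (k / 2) * expR (- d / 2).
  apply: mulr_ge0 (expR_ge0 _); apply: mulr_ge0 (expR_ge0 _).
  by apply: mulr_ge0 => //; exact: sqr_ge0.
have [V0|V0] := leP 0 V.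
  rewrite (ger0_norm V0) in hU.
  apply: le_trans (tilted_cauchy_majorant_aux th01 k0 V0 he hU) _.
  by rewrite ler_wpM2l// lerDl.
rewrite (ltr0_norm V0) in hU.
have V0' : 0 <= - V by lra.
rewrite -normrN in he.
apply: le_trans (tilted_cauchy_majorant_aux th01 k0 V0' he hU) _.
by rewrite ler_wpM2l// mulrN lerDr.
Qed.

(** * Probability of disagreement for one pair of classes *)

Section tilted_normal.
Context {R : realType} {p : nat}.
Variables (mu : 'cV[R]_p) (Sigma S : 'M[R]_p) (nu : probability 'cV[R]_p R).
Hypotheses (Sigma_posdef : posdef Sigma) (S_inv : is_inv_sqrt Sigma S).
Hypothesis nu_normal : is_normal nu mu Sigma.

Let z (x : 'cV[R]_p) := S *m (x - mu).

Let mz u : measurable_fun setT (fun x => dot u (z x)).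
Proof. exact: (measurable_standardized_dot _ S_inv u). Qed.

(** Under the density [expR (dot y (z x))] the form [dot a (z x)] is normal with mean [dot a y] and
    unchanged variance, so [cauchy_kernel_bound] applies to its centred and rescaled version. *)
Lemma tilted_kernel_bound (a y : 'cV[R]_p) (th : R) : a != 0 -> 0 < th ->
  (\int[nu]_x (expR (dot y (z x)) *
     (1 + ((dot a (z x) - dot a y) / th) ^+ 2)^-1)%:E <=
   (expR (sqnorm y / 2) * Num.sqrt (2 * pi / (sqnorm a / th ^+ 2)))%:E)%E.
Proof.
move=> a0 th0.
have sa0 : 0 < sqnorm a by rewrite lt_neqAle eq_sym sqnorm_eq0 a0 sqnorm_ge0.
apply: cauchy_kernel_bound => //.
- by apply: measurableT_comp => //; exact: mz.
- by apply: measurable_funM => //; apply: measurable_funB => //; exact: mz.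
- by rewrite divr_gt0// exprn_gt0.
- move=> h.
  have e1 x : expR (dot y (z x)) * expR (h * ((dot a (z x) - dot a y) / th)) =
     expR (- (h / th * dot a y)) * expR (dot (y + (h / th) *: a) (z x)).
    rewrite -!expRD dotDl dotZl; congr expR; field; by rewrite gt_eqF.
  under eq_integral do rewrite e1 EFinM.
  rewrite ge0_integralZl_EFin ?expR_ge0//; last first.
    by apply/measurable_EFinP; apply: measurableT_comp => //; exact: mz.
  rewrite (mgf_standardized Sigma_posdef S_inv nu_normal) -EFinM -!expRD.
  congr (expR _)%:E; rewrite sqnormD sqnormZ dotZr (dotC y a).
  by field; rewrite gt_eqF.
Qed.

Lemma half_space_prob_ge (a : 'cV[R]_p) : a != 0 ->
  ((normal_peak (Num.sqrt (sqnorm a)) *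
     expR (- (sqnorm a / 8 + 1 / 2 + 1 / (2 * sqnorm a))))%:E <=
   nu [set x | sqnorm a / 2 <= dot a (z x)]%R)%E.
Proof.
move=> a0.
have sa0 : 0 < sqnorm a by rewrite lt_neqAle eq_sym sqnorm_eq0 a0 sqnorm_ge0.
have s0 : 0 < Num.sqrt (sqnorm a) by rewrite sqrtr_gt0.
have := normal_prob_tail_ge (dot (S *m a) mu) s0.
rewrite sqr_sqrtr ?sqnorm_ge0// => /le_trans; apply.
rewrite -(standardized_law Sigma_posdef S_inv nu_normal a0)//.
rewrite le_eqVlt; apply/orP; left; apply/eqP; congr (nu _).
apply/seteqP; split => x /=; rewrite /z (standardized_dot _ S_inv) in_itv/= andbT;
  by rewrite lerBrDl.
Qed.

(** The integrated majorant and the lower bound of [half_space_prob_ge] both have the order of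
    [expR (- sqnorm a / 8)] divided by [|a|]; the majorant has the extra factor [th]. *)
Lemma symdiff_prob_le (a b : 'cV[R]_p) (th k c1 : R) (D : set 'cV[R]_p) :
  0 < c1 <= sqnorm a -> 0 < th <= 1 -> 0 <= k ->
  dot a b = sqnorm b -> sqnorm b <= k * th ^+ 2 -> measurable D ->
  (forall x, D x ->
     `|dot a (z x) - sqnorm a / 2| <= k * th + `|dot b (z x)|) ->
  (nu D <= (8 * pi * (1 + 4 * k) ^+ 2 * expR (13 / 2 * k) *
            expR (1 / 2 + 1 / (2 * c1)) * th)%:E *
           nu [set x | sqnorm a / 2 <= dot a (z x)]%R)%E.
Proof.
move=> /andP[c10 c1a] th01 k0 ab bk mD HD; have /andP[th0 th1] := th01.
have sa0 : 0 < sqnorm a by exact: lt_le_trans c1a.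
have a0 : a != 0 by rewrite -sqnorm_eq0 gt_eqF.
pose d := sqnorm a / 2.
pose c := 2 * (1 + 4 * k) ^+ 2 * expR (k / 2) * expR (- d / 2).
have c0 : 0 <= c.
  apply: mulr_ge0 (expR_ge0 _); apply: mulr_ge0 (expR_ge0 _).
  by apply: mulr_ge0 => //; exact: sqr_ge0.
(* The two tilting directions. As [dot a b = sqnorm b], their products with [a] are exactly the
   centres in [tilted_cauchy_majorant]. *)
pose y1 := 2^-1 *: a + (3 / th) *: b.
pose y2 := 2^-1 *: a - (3 / th) *: b.
pose f (y : 'cV[R]_p) x := expR (dot y (z x)) *
  (1 + ((dot a (z x) - dot a y) / th) ^+ 2)^-1.
have f0 y x : 0 <= f y x.
  by rewrite mulr_ge0 ?expR_ge0// invr_ge0 addr_ge0// sqr_ge0.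
have mf y : measurable_fun setT (f y).
  apply: measurable_funM; first by apply: measurableT_comp => //; exact: mz.
  apply: (measurableT_comp (f := fun y : R => (1 + y ^+ 2)^-1)).
    exact: measurable_cauchy_kernel.
  by apply: measurable_funM => //; apply: measurable_funB => //; exact: mz.
have ay1 : dot a y1 = d + 3 / th * sqnorm b.
  by rewrite /y1 dotDr !dotZr ab /d /sqnorm; ring.
have ay2 : dot a y2 = d - 3 / th * sqnorm b.
  by rewrite /y2 dotDr dotNr !dotZr ab /d /sqnorm; ring.
have step1 : (nu D <= \int[nu]_x (c%:E * ((f y1 x)%:E + (f y2 x)%:E)))%E.
  rewrite -[D in leLHS]setIT -integral_indic//.
  apply: ge0_le_integral => //.
  - exact/measurable_EFinP/measurable_indic.
  - apply: measurable_funeM; apply: emeasurable_funD;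
      apply/measurable_EFinP; exact: mf.
  move=> x _; rewrite -EFinD -EFinM lee_fin indicE.
  have [xD|] := boolP (x \in D); last by rewrite mulr_ge0// addr_ge0.
  move: xD; rewrite inE => /HD hx.
  have rb : 0 <= sqnorm b <= k * th ^+ 2 by rewrite sqnorm_ge0.
  have := tilted_cauchy_majorant th01 k0 rb hx.
  rewrite /c /f ay1 ay2 /y1 /y2 !dotDl dotNl !dotZl.
  by rewrite (mulrC 2^-1).
apply: (le_trans step1).
pose q := normal_peak (Num.sqrt (sqnorm a)).
have q0 : 0 <= q by exact: normal_peak_ge0.
(* Expressed through the peak [q] of the normal density, in order to match [half_space_prob_ge]. *)
have sqrtE : Num.sqrt (2 * pi / (sqnorm a / th ^+ 2)) = th * (2 * pi) * q.
  have pi0 := pi_gt0 R.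
  have W0 : 0 < sqnorm a * pi *+ 2 by rewrite pmulrn_lgt0// mulr_gt0.
  rewrite -[RHS]ger0_norm; last by rewrite !mulr_ge0// ltW.
  rewrite -sqrtr_sqr; congr Num.sqrt.
  rewrite /q /normal_peak sqr_sqrtr ?sqnorm_ge0// exprMn exprVn sqr_sqrtr ?ltW//.
  have -> : sqnorm a * pi *+ 2 = 2 * (sqnorm a * pi) by rewrite mulr_natl.
  move: (@pi R) pi0 => P P0.
  by field; rewrite !gt_eqF.
rewrite ge0_integralZl_EFin//; last 2 first.
- by move=> x _; rewrite -EFinD lee_fin addr_ge0.
- by apply: emeasurable_funD; apply/measurable_EFinP; exact: mf.
rewrite ge0_integralD//; try (apply/measurable_EFinP; exact: mf);
  try by move=> x _; rewrite lee_fin.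
apply: (@le_trans _ _ (c%:E * ((expR (sqnorm y1 / 2) * (th * (2 * pi) * q))%:E +
    (expR (sqnorm y2 / 2) * (th * (2 * pi) * q))%:E))%E).
  apply: lee_wpmul2l => //; rewrite -sqrtE.
  by apply: leeD; exact: tilted_kernel_bound.
apply: (@le_trans _ _ ((8 * pi * (1 + 4 * k) ^+ 2 * expR (13 / 2 * k) *
    expR (1 / 2 + 1 / (2 * c1)) * th) *
    (q * expR (- (sqnorm a / 8 + 1 / 2 + 1 / (2 * sqnorm a)))))%:E); last first.
  rewrite EFinM; apply: lee_wpmul2l; last exact: half_space_prob_ge.
  rewrite lee_fin; apply: mulr_ge0; last exact: ltW.
  apply: mulr_ge0 (expR_ge0 _); apply: mulr_ge0 (expR_ge0 _).
  by apply: mulr_ge0; rewrite ?sqr_ge0// mulr_ge0// pi_ge0.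
rewrite -EFinD -EFinM lee_fin -mulrDl.
have rk : 3 / th * sqnorm b <= 3 * k.
  rewrite mulrAC ler_pdivrMr//; apply: (@le_trans _ _ (3 * (k * th ^+ 2))).
    by rewrite ler_wpM2l.
  rewrite -mulrA ler_wpM2l// ler_wpM2l// expr2.
  by rewrite ler_piMl// ltW.
have r2k : (3 / th) ^+ 2 * sqnorm b <= 9 * k.
  rewrite expr_div_n mulrAC ler_pdivrMr ?exprn_gt0//.
  have -> : 9 * k * th ^+ 2 = 3 ^+ 2 * (k * th ^+ 2) by ring.
  by rewrite ler_wpM2l ?sqr_ge0.
have r0 : 0 <= 3 / th * sqnorm b by rewrite mulr_ge0 ?sqnorm_ge0// divr_ge0// ltW.
(* The cross term contributes at most [3 * k / 2] and the square of the [b] part at most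
   [9 * k / 2]. *)
have Y1 : expR (sqnorm y1 / 2) <= expR (sqnorm a / 8 + 6 * k).
  rewrite ler_expR /y1 sqnormD !sqnormZ dotZl dotZr ab.
  by move: r2k rk r0; set r1 := 3 / th * _; set r2 := _ ^+ 2 * sqnorm b; lra.
have Y2 : expR (sqnorm y2 / 2) <= expR (sqnorm a / 8 + 6 * k).
  rewrite ler_expR /y2 -scaleNr sqnormD !sqnormZ dotZl dotZr ab sqrrN mulNr.
  by move: r2k rk r0; set r1 := 3 / th * _; set r2 := _ ^+ 2 * sqnorm b; lra.
have tq0 : 0 <= th * (2 * pi) * q.
  by apply: mulr_ge0 => //; apply: mulr_ge0; rewrite ?mulr_ge0 ?pi_ge0// ltW.
apply: (@le_trans _ _ (c * (2 * expR (sqnorm a / 8 + 6 * k) * (th * (2 * pi) * q)))).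
  by apply: ler_wpM2l => //; apply: ler_wpM2r => //; lra.
have -> : c * (2 * expR (sqnorm a / 8 + 6 * k) * (th * (2 * pi) * q)) =
    (8 * pi * (1 + 4 * k) ^+ 2 * th * q) *
    (expR (k / 2) * expR (- d / 2) * expR (sqnorm a / 8 + 6 * k)).
  by rewrite /c; ring.
have -> : 8 * pi * (1 + 4 * k) ^+ 2 * expR (13 / 2 * k) *
    expR (1 / 2 + 1 / (2 * c1)) * th *
    (q * expR (- (sqnorm a / 8 + 1 / 2 + 1 / (2 * sqnorm a)))) =
    (8 * pi * (1 + 4 * k) ^+ 2 * th * q) *
    (expR (13 / 2 * k) * expR (1 / 2 + 1 / (2 * c1)) *
     expR (- (sqnorm a / 8 + 1 / 2 + 1 / (2 * sqnorm a)))).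
  by ring.
apply: ler_wpM2l.
  apply: mulr_ge0 => //; apply: mulr_ge0; last exact: ltW.
  by apply: mulr_ge0; rewrite ?sqr_ge0// mulr_ge0// pi_ge0.
(* Exponents: [k / 2 + 6 * k = 13 / 2 * k] and [- d / 2 + sqnorm a / 8 = - sqnorm a / 8]; the rest
   follows from [c1 <= sqnorm a]. *)
rewrite -!expRD ler_expR /d.
have : 1 / (2 * sqnorm a) <= 1 / (2 * c1).
  by rewrite !div1r lef_pV2 ?posrE ?mulr_gt0// ler_wpM2l.
lra.
Qed.

End tilted_normal.

(** * Misclassification rates *)

Lemma measurable_forall_lt0 d (Y : measurableType d) (R : realType) (K : nat)
    (P : pred 'I_K) (f : 'I_K -> Y -> R) :
  (forall j, measurable_fun setT (f j)) ->
  measurable [set y | forall j, P j -> f j y < 0].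
Proof.
move=> mf.
have -> : [set y | forall j, P j -> f j y < 0] =
    \bigcap_(j in [set j | P j]) [set y | f j y < 0] by [].
apply: fin_bigcap_measurable => [|j _]; first exact: finite_finset.
rewrite -[X in measurable X]setTI.
by apply: (measurable_fun_ltr (mf j)).
Qed.

(** Here [A], [B] and [r] stand for the squared norms of [a], its estimate and the orthogonal
    remainder. Multiplying the estimated threshold [dh] by [t] brings it to the scale of [a], and
    [r <= (1 - (1 - x) ^+ 3) * A]. *)
Lemma perturbation_bounds (R : realType) (A B r t dh x : R) :
  0 <= A -> 0 <= x <= 1 / 4 -> A = t ^+ 2 * B + r ->
  `|A - B| <= x * A -> `|t - 1| <= x -> `|A / 2 - dh| <= x * B ->
  [/\ 0 < t, r <= 3 * (x * A) & `|A / 2 - t * dh| <= 3 * (x * A)].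
Proof.
move=> A0 /andP[x0 x1] AE; rewrite !ler_norml.
move=> /andP[B1 B2] /andP[t1 t2] /andP[d1 d2].
have t0 : 0 < t by lra.
have xA : 0 <= x * A by nra.
have BA : B <= 5 / 4 * A by nra.
have B0 : 0 <= B by nra.
have xB : x * B <= 5 / 4 * (x * A) by nra.
split => //.
- have tt : (1 - x) ^+ 2 <= t ^+ 2 by rewrite ler_sqr ?nnegrE; lra.
  have BB : (1 - x) * A <= B by lra.
  have h1 : (1 - x) ^+ 2 * ((1 - x) * A) <= t ^+ 2 * B.
    apply: ler_pM => //; first exact: sqr_ge0.
    by apply: mulr_ge0; lra.
  have h2 : (1 - 3 * x) * A <= (1 - x) ^+ 2 * ((1 - x) * A).
    rewrite mulrA ler_wpM2r//.
    have -> : (1 - x) ^+ 2 * (1 - x) = 1 - 3 * x + x ^+ 2 * (3 - x) by ring.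
    by rewrite lerDl mulr_ge0 ?sqr_ge0//; lra.
  lra.
(* With [0 <= dh <= A], passing from [dh] to [t * dh] costs at most [x * A], on top of
   [x * B <= 5 / 4 * (x * A)]. *)
- have dh0 : 0 <= dh by nra.
  have dhA : dh <= A by nra.
  have h1 : (t - 1) * dh <= x * A by nra.
  have h2 : - (x * A) <= (t - 1) * dh by nra.
  by apply/andP; split; lra.
Qed.

Section rules.
Context {R : realType} {p K : nat}.
Variables (mu : 'I_K -> 'cV[R]_p) (Sigma S : 'M[R]_p).
Hypothesis S_inv : is_inv_sqrt Sigma S.

Lemma mahalanobis2E u v : mahalanobis2 Sigma u v = sqnorm (S *m (u - v)).
Proof.
by rewrite /mahalanobis2 /sqnorm -S_inv.2 -mulmxA (dot_mulmx (u - v)) S_inv.1.1.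
Qed.

(** With [z = S *m (x - mu i)] the comparison is between [|z|^2] and [|z - a|^2], and [|z|^2]
    cancels. *)
Lemma opt_rule_ltP x i j :
  (mahalanobis2 Sigma x (mu i) < mahalanobis2 Sigma x (mu j)) =
  (dot (avec mu S j i) (S *m (x - mu i)) < sqnorm (avec mu S j i) / 2).
Proof.
rewrite !mahalanobis2E.
have -> : S *m (x - mu j) = S *m (x - mu i) + -1 *: avec mu S j i.
  rewrite /avec scaleN1r -mulmxN -mulmxDr; congr (S *m _).
  by rewrite opprB addrA subrK.
rewrite sqnormD sqnormZ dotZr dotC.
by apply/idP/idP; lra.
Qed.

Lemma linear_rule_ltP (ah bh : 'I_K -> 'I_K -> 'cV[R]_p) x i j :
  (dot (ah j i) (S *m (x - bh j i)) < 0) =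
  (dot (ah j i) (S *m (x - mu i)) < dcoef mu S ah bh j i).
Proof.
rewrite /dcoef -[RHS]subr_lt0 -dotNr -dotDr; congr (dot _ _ < 0).
by rewrite -mulmxN -mulmxDr; congr (S *m _); rewrite opprB addrA subrK.
Qed.

Lemma dcoef_avec j i :
  dcoef mu S (avec mu S) (bvec mu) j i = sqnorm (avec mu S j i) / 2.
Proof.
rewrite /dcoef /sqnorm.
have -> : S *m (bvec mu j i - mu i) = 2^-1 *: avec mu S j i.
  rewrite /avec scalemxAr; congr (S *m _).
  rewrite /bvec scalerDr scalerBr -addrA; congr (_ + _).
  by rewrite -[X in _ - X]scale1r -scalerBl -scaleNr; congr (_ *: _); lra.
by rewrite dotZr mulrC.
Qed.

Lemma le_Mmax j i : j != i -> sqnorm (avec mu S j i) <= Mmax mu Sigma.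
Proof.
move=> ji; rewrite /Mmax /avec -mahalanobis2E.
apply: (@le_trans _ _ (\big[Num.max/0]_(l < K | l != i)
    mahalanobis2 Sigma (mu l) (mu i))).
  exact: (le_bigmax_cond _ (fun l => mahalanobis2 Sigma (mu l) (mu i))).
exact: (le_bigmax _ (fun i => \big[Num.max/0]_(l < K | l != i)
  mahalanobis2 Sigma (mu l) (mu i))).
Qed.

End rules.

Lemma measure_bigsetU_le d (T : measurableType d) (R : realType)
    (nu : {measure set T -> \bar R}) (I : Type) (r : seq I) (D : I -> set T) :
  (forall j, measurable (D j)) ->
  (nu (\big[setU/set0]_(j <- r) D j) <= \sum_(j <- r) nu (D j))%E.
Proof.
move=> mD; elim: r => [|j r IH]; first by rewrite !big_nil measure0.
rewrite !big_cons; apply: le_trans (leeD (lexx _) IH).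
by apply: measureU2 => //; exact: bigsetU_measurable.
Qed.

(** The two unions differ only inside the union of the pairwise symmetric differences, at most [K]
    sets, each of measure at most [c] times that of the whole union of the [E j]. *)
Lemma error_perturbation d (T : measurableType d) (R : realType)
    (nu : probability T R) (K : nat) (P : pred 'I_K) (E E' : 'I_K -> set T)
    (c : R) :
  0 <= c -> (forall j, measurable (E j)) -> (forall j, measurable (E' j)) ->
  (forall j, P j ->
     nu ((E j `\` E' j) `|` (E' j `\` E j)) <= c%:E * nu (E j))%E ->
  `|fine (nu [set x | exists2 j, P j & E' j x]) -
    fine (nu [set x | exists2 j, P j & E j x])| <=
  K%:R * c * fine (nu [set x | exists2 j, P j & E j x]).
Proof.
move=> c0 mE mE' h.
set F := [set x | exists2 j, P j & E' j x].
set G := [set x | exists2 j, P j & E j x].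
have mex (B : 'I_K -> set T) : (forall j, measurable (B j)) ->
    measurable [set x | exists2 j, P j & B j x].
  move=> mB; have -> : [set x | exists2 j, P j & B j x] =
      \bigcup_(j in [set j | P j]) B j.
    by apply/seteqP; split => x [j Pj Bj]; exists j.
  by apply: fin_bigcup_measurable => // j _; exact: mB.
have mF : measurable F by exact: mex.
have mG : measurable G by exact: mex.
have nuE A : measurable A -> nu A = (fine (nu A))%:E.
  by move=> mA; rewrite fineK// fin_num_measure.
pose D j := if P j then (E j `\` E' j) `|` (E' j `\` E j) else set0.
have mD j : measurable (D j).
  by rewrite /D; case: ifP => // _; apply: measurableU; exact: measurableD.
pose U := \big[setU/set0]_(j <- index_enum 'I_K) D j.
have mU : measurable U by exact: bigsetU_measurable.
have DU j x : D j x -> U x.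
  move=> Djx; rewrite /U -bigcup_seq; exists j => //=.
  exact: mem_index_enum.
have DG j : (nu (D j) <= (c * fine (nu G))%:E)%E.
  rewrite /D; case: ifPn => Pj.
    apply: le_trans (h j Pj) _; rewrite EFinM -nuE//.
    apply: lee_wpmul2l; first by rewrite lee_fin.
    by apply: le_measure; rewrite ?inE// => x Ex; exists j.
  by rewrite measure0 lee_fin mulr_ge0// fine_ge0.
have UG : fine (nu U) <= K%:R * c * fine (nu G).
  rewrite -lee_fin -nuE//; apply: le_trans (measure_bigsetU_le _ _ mD) _.
  apply: (@le_trans _ _ (\sum_(j <- index_enum 'I_K) (c * fine (nu G))%:E)%E).
    by apply: lee_sum => j _; exact: DG.
  by rewrite sumEFin lee_fin sumr_const card_ord -[leLHS]mulr_natl mulrA.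
have sub A B : measurable A -> measurable B -> A `<=` B `|` U ->
    fine (nu A) <= fine (nu B) + fine (nu U).
  move=> mA mB AB; rewrite -lee_fin EFinD -!nuE//.
  apply: (@le_trans _ _ (nu (B `|` U))); last exact: measureU2.
  by apply: le_measure; rewrite ?inE//; exact: measurableU.
have FG : fine (nu F) <= fine (nu G) + fine (nu U).
  apply: sub => // x [j Pj E'j]; have [Ej|nEj] := pselect (E j x).
    by left; exists j.
  by right; apply: (DU j); rewrite /D Pj; right.
have GF : fine (nu G) <= fine (nu F) + fine (nu U).
  apply: sub => // x [j Pj Ej]; have [E'j|nEj] := pselect (E' j x).
    by left; exists j.
  by right; apply: (DU j); rewrite /D Pj; left.
by rewrite ler_norml; lra.
Qed.

(** * Relative error of the misclassification rate for a fixed sample *)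

Section misclassification_ratio.
Context {R : realType} {p K : nat}.
Variables (mu : 'I_K -> 'cV[R]_p) (Sigma S : 'M[R]_p).
Variable nu : 'I_K -> probability 'cV[R]_p R.
Hypotheses (Sigma_posdef : posdef Sigma) (S_inv : is_inv_sqrt Sigma S).
Hypothesis nu_normal : forall i, is_normal (nu i) (mu i) Sigma.

Lemma not_opt_ruleE i : [set x | ~ opt_rule mu Sigma x i] =
  [set x | exists2 j, j != i &
     sqnorm (avec mu S j i) / 2 <= dot (avec mu S j i) (S *m (x - mu i))].
Proof.
apply/seteqP; split => x /=.
  move=> /existsNP[j /not_implyP[ji /negP]].
  by rewrite (opt_rule_ltP _ S_inv) -leNgt => h; exists j.
move=> [j ji h] /(_ j ji); rewrite (opt_rule_ltP _ S_inv).
by rewrite ltNge h.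
Qed.

Lemma not_linear_ruleE ah bh i : [set x | ~ linear_rule S ah bh x i] =
  [set x | exists2 j, j != i &
     dcoef mu S ah bh j i <= dot (ah j i) (S *m (x - mu i))].
Proof.
apply/seteqP; split => x /=.
  move=> /existsNP[j /not_implyP[ji /negP]].
  by rewrite (linear_rule_ltP mu) -leNgt => h; exists j.
move=> [j ji h] /(_ j ji); rewrite (linear_rule_ltP mu).
by rewrite ltNge h.
Qed.

Let M := Mmax mu Sigma.

Variables (ah bh aperp : 'I_K -> 'I_K -> 'cV[R]_p) (t : 'I_K -> 'I_K -> R).
Variables (C s c1 : R).
Hypotheses (K_ge2 : (2 <= K)%N) (C0 : 0 <= C) (s0 : 0 < s) (c10 : 0 < c1).
Hypothesis mu_sep : forall i j, i != j ->
  c1 <= mahalanobis2 Sigma (mu i) (mu j).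
Hypothesis decomp : forall j i, j != i ->
  orth_decomposition (avec mu S j i) (t j i) (ah j i) (aperp j i).
Hypotheses (Cs : C * s <= 1 / 4) (Ms : M * s <= 1).
Hypothesis a_close : forall j i, j != i ->
  `|sqnorm (avec mu S j i) - sqnorm (ah j i)| <= C * s * sqnorm (avec mu S j i).
Hypothesis t_close : forall j i, j != i -> `|t j i - 1| <= C * s.
Hypothesis d_close : forall j i, j != i ->
  `|dcoef mu S (avec mu S) (bvec mu) j i - dcoef mu S ah bh j i| <=
  C * s * sqnorm (ah j i).

(* The constant of [symdiff_prob_le] for [k := 3 * C]. *)
Definition ratio_constant (C c1 : R) : R :=
  8 * pi * (1 + 4 * (3 * C)) ^+ 2 * expR (13 / 2 * (3 * C)) *
  expR (1 / 2 + 1 / (2 * c1)).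

Lemma ratio_constant_ge0 : 0 <= ratio_constant C c1.
Proof.
rewrite /ratio_constant; apply: mulr_ge0 (expR_ge0 _).
apply: mulr_ge0 (expR_ge0 _).
by apply: mulr_ge0; rewrite ?sqr_ge0// mulr_ge0// pi_ge0.
Qed.

Lemma avec_sqnorm_ge j i : j != i -> c1 <= sqnorm (avec mu S j i).
Proof. by move=> ji; rewrite /avec -(mahalanobis2E S_inv); exact: mu_sep. Qed.

Lemma Mmax_ge : c1 <= M.
Proof.
pose i0 : 'I_K := Ordinal (ltn_trans (ltnSn 0) K_ge2).
pose j0 : 'I_K := Ordinal K_ge2.
have ne : j0 != i0 by [].
exact: le_trans (avec_sqnorm_ge ne) (le_Mmax mu S_inv ne).
Qed.

Let th := Num.sqrt (M * s).

Let Ms0 : 0 < M * s.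
Proof. by rewrite mulr_gt0// (lt_le_trans c10 Mmax_ge). Qed.

Let th01 : 0 < th <= 1.
Proof. by rewrite /th sqrtr_gt0 Ms0/= -sqrtr1 ler_sqrt. Qed.

(** Both errors are unions of half-spaces indexed by the competing class [j]. Each pair is handled
    by [symdiff_prob_le] with the orthogonal remainder as [b] and [k := 3 * C]. *)
Lemma class_error_close i :
  `|fine (nu i [set x | ~ linear_rule S ah bh x i]) -
    fine (nu i [set x | ~ opt_rule mu Sigma x i])| <=
  K%:R * (ratio_constant C c1 * th) *
  fine (nu i [set x | ~ opt_rule mu Sigma x i]).
Proof.
rewrite not_opt_ruleE not_linear_ruleE.
have /andP[th0 th1] := th01.
have mz u := @measurable_standardized_dot _ _ (mu i) _ _ S_inv u.
have mhalf u c : measurable [set x | c <= dot u (S *m (x - mu i))].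
  rewrite -[X in measurable X]setTI.
  by apply: (measurable_fun_ler (measurable_cst c) (mz u)).
apply: (error_perturbation (P := fun j => j != i)
  (E := fun j => [set x | sqnorm (avec mu S j i) / 2 <=
                     dot (avec mu S j i) (S *m (x - mu i))])
  (E' := fun j => [set x | dcoef mu S ah bh j i <=
                     dot (ah j i) (S *m (x - mu i))])) => //.
  by rewrite mulr_ge0 ?ratio_constant_ge0// ltW.
move=> j ji.
set a := avec mu S j i; set b := aperp j i; set r := sqnorm b.
have [aE bah] := decomp ji; rewrite -/a -/b in aE bah.
have ab : dot a b = sqnorm b.
  by rewrite aE dotDl dotZl (dotC (ah j i)) bah mulr0 add0r.
have A0 : 0 <= sqnorm a := sqnorm_ge0 a.
have AE : sqnorm a = t j i ^+ 2 * sqnorm (ah j i) + r.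
  by rewrite {1}aE sqnormD sqnormZ dotZl (dotC (ah j i)) bah !mulr0 addr0.
have x01 : 0 <= C * s <= 1 / 4 by rewrite Cs mulr_ge0// ltW.
have dcl := d_close ji; rewrite (dcoef_avec mu S) -/a in dcl.
have [t0 rle dle] := perturbation_bounds A0 x01 AE (a_close ji) (t_close ji) dcl.
have th2 : th ^+ 2 = M * s by rewrite sqr_sqrtr// ltW.
have AM : 3 * (C * s * sqnorm a) <= 3 * C * th ^+ 2.
  rewrite th2; have -> : 3 * C * (M * s) = 3 * (C * s * M) by ring.
  rewrite ler_wpM2l// ler_wpM2l//; first by case/andP: x01.
  exact: le_Mmax.
apply: (symdiff_prob_le Sigma_posdef S_inv (nu_normal i) (b := b)
  (k := 3 * C)) => //.
- by rewrite c10 avec_sqnorm_ge.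
- by rewrite mulr_ge0.
- exact: le_trans AM.
- by apply: measurableU; apply: measurableD; exact: mhalf.
move=> x /=.
have UE : dot a (S *m (x - mu i)) =
    t j i * dot (ah j i) (S *m (x - mu i)) + dot b (S *m (x - mu i)).
  by rewrite {1}aE dotDl dotZl.
have Ath : 3 * (C * s * sqnorm a) <= 3 * C * th.
  by apply: le_trans AM _; rewrite expr2 mulrA ler_piMr// mulr_ge0// ?mulr_ge0// ltW.
move: UE dle; set U := dot a _; set W := dot (ah j i) _; set V := dot b _.
set dh := dcoef _ _ _ _ _ _ => UE; rewrite ler_norml => /andP[dle1 dle2].
have V1 := ler_norm V; have V2 := ler_norm (- V); rewrite normrN in V2.
(* Since [U = t W + V] with [t > 0], disagreement puts [U] and [t W] on different sides of [d] and
   [t * dh], so [|U - d| <= |d - t * dh| + |V|]. *)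
case=> [[h1 /negP]|[h1 /negP]]; rewrite -ltNge => h2.
  have h3 : t j i * W < t j i * dh by rewrite ltr_pM2l.
  by rewrite ger0_norm; lra.
have h3 : t j i * dh <= t j i * W by rewrite ler_pM2l.
by rewrite ltr0_norm; lra.
Qed.

(** The error of class 0 against class 1 alone is positive, by [half_space_prob_ge]. *)
Lemma opt_error_gt0 : 0 < misclassification_rate nu (opt_rule mu Sigma).
Proof.
pose i0 : 'I_K := Ordinal (ltn_trans (ltnSn 0) K_ge2).
pose j0 : 'I_K := Ordinal K_ge2.
have ne : j0 != i0 by [].
rewrite /misclassification_rate (bigD1 i0)//= ltr_pwDl//; last first.
  by apply: sumr_ge0 => i _; rewrite mulr_ge0 ?invr_ge0// fine_ge0.
rewrite mulr_gt0 ?invr_gt0 ?ltr0n ?(ltn_trans _ K_ge2)//.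
set a := avec mu S j0 i0.
have sa0 : 0 < sqnorm a by rewrite (lt_le_trans c10)// avec_sqnorm_ge.
have a0 : a != 0 by rewrite -sqnorm_eq0 gt_eqF.
have := half_space_prob_ge Sigma_posdef S_inv (nu_normal i0) a0.
set q := _ * expR _ => hq.
have q0 : 0 < q by rewrite mulr_gt0 ?expR_gt0// normal_peak_gt0// gt_eqF// sqrtr_gt0.
have mz u c : measurable [set x | c <= dot u (S *m (x - mu i0))].
  rewrite -[X in measurable X]setTI.
  by apply: (measurable_fun_ler (measurable_cst c)
    (@measurable_standardized_dot _ _ (mu i0) _ _ S_inv u)).
have mG : measurable [set x | ~ opt_rule mu Sigma x i0].
  rewrite not_opt_ruleE.
  rewrite (_ : [set x | _] = \bigcup_(j in [set j | j != i0])
    [set x | sqnorm (avec mu S j i0) / 2 <=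
             dot (avec mu S j i0) (S *m (x - mu i0))]).
    apply: fin_bigcup_measurable => [|j _]; first exact: finite_finset.
    exact: mz.
  by apply/seteqP; split => x [j ji h]; exists j.
apply: (lt_le_trans q0); rewrite -lee_fin fineK ?fin_num_measure//.
apply: (le_trans hq); apply: le_measure; rewrite ?inE//.
by rewrite not_opt_ruleE => x h; exists j0.
Qed.

(** The bound of [class_error_close] is relative with the same factor for every class, so it
    survives averaging. *)
Lemma misclassification_ratio_le :
  `|misclassification_rate nu (linear_rule S ah bh) /
    misclassification_rate nu (opt_rule mu Sigma) - 1| <=
  K%:R * (ratio_constant C c1 * th).
Proof.
have R0 := opt_error_gt0.
rewrite -[X in _ - X](divff (lt0r_neq0 R0)) -mulrBl normrM normfV (gtr0_norm R0).
rewrite ler_pdivrMr// /misclassification_rate -sumrB.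
apply: le_trans (ler_norm_sum _ _ _) _.
rewrite mulr_sumr; apply: ler_sum => i _.
rewrite -mulrBr normrM ger0_norm ?invr_ge0// [leRHS]mulrCA.
by rewrite ler_wpM2l ?invr_ge0//; exact: class_error_close.
Qed.

End misclassification_ratio.

(** * Measurability of the random quantities *)

Lemma measurable_misclassification_rate d (T : measurableType d) (R : realType)
    (p K : nat) (nu : 'I_K -> probability 'cV[R]_p R) (S : 'M[R]_p)
    (a b : T -> 'I_K -> 'I_K -> 'cV[R]_p) :
  (forall j i, measurable_fun setT (fun w => a w j i)) ->
  (forall j i, measurable_fun setT (fun w => b w j i)) ->
  measurable_fun setT
    (fun w => misclassification_rate nu (linear_rule S (a w) (b w))).
Proof.
move=> ma mb; rewrite /misclassification_rate.
apply: measurable_sum => i; apply: measurable_funM => //.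
apply: measurableT_comp; first exact: fine_measurable.
(* Correct assignment as a subset of the product of sample and observation; the error is the measure
   of a section of its complement. *)
pose A := [set z : T * 'cV[R]_p | forall j, j != i ->
  dot (a z.1 j i) (S *m (z.2 - b z.1 j i)) < 0].
have mA : measurable A.
  apply: (measurable_forall_lt0 (fun j => j != i)
    (f := fun j (z : T * 'cV[R]_p) =>
            dot (a z.1 j i) (S *m (z.2 - b z.1 j i)))) => j.
  under eq_fun do rewrite dotE.
  apply: measurable_sum => k.
  have mcoord (f : T -> 'cV[R]_p) l : measurable_fun setT f ->
      measurable_fun setT (fun z : T * 'cV[R]_p => f z.1 l 0).
    move=> mf; apply: (measurableT_comp (f := fun x : 'cV[R]_p => x l 0)).
      exact: measurable_coord.
    exact: measurableT_comp.
  apply: measurable_funM; first exact: (mcoord _ _ (ma j i)).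
  under eq_fun do rewrite mxE.
  apply: measurable_sum => l; apply: measurable_funM => //.
  under eq_fun do rewrite !mxE.
  apply: measurable_funB; last exact: (mcoord _ _ (mb j i)).
  apply: (measurableT_comp (f := fun x : 'cV[R]_p => x l 0)) => //.
  exact: measurable_coord.
have -> : (fun w => nu i [set x | ~ linear_rule S (a w) (b w) x i]) =
    nu i \o xsection (~` A).
  apply/funext => w /=; congr (nu i _); apply/seteqP.
  by split => x; rewrite /xsection/= inE.
by apply: measurable_fun_xsection; exact: measurableC.
Qed.

Lemma measurable_exists_lt d (T : measurableType d) (R : realType) (K : nat)
    (f g : 'I_K -> 'I_K -> T -> R) :
  (forall j i, measurable_fun setT (f j i)) ->
  (forall j i, measurable_fun setT (g j i)) ->
  measurable [set w | exists j i, j != i /\ f j i w < g j i w].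
Proof.
move=> mf mg.
rewrite (_ : [set w | _] = \bigcup_(q in [set q : 'I_K * 'I_K | q.1 != q.2])
  [set w | f q.1 q.2 w < g q.1 q.2 w]).
  apply: fin_bigcup_measurable => [|q _]; first exact: finite_finset.
  rewrite -[X in measurable X]setTI.
  exact: (measurable_fun_ltr (mf _ _) (mg _ _)).
apply/seteqP; split => w /=.
  by move=> [j [i [ji h]]]; exists (j, i).
by move=> [[j i] /= ji h]; exists j, i.
Qed.

Lemma measurable_sqnorm d (T : measurableType d) (R : realType) (p : nat)
    (f : T -> 'cV[R]_p) :
  measurable_fun setT f -> measurable_fun setT (fun w => sqnorm (f w)).
Proof.
move=> mf; rewrite /sqnorm; under eq_fun do rewrite dotE.
have mc k : measurable_fun setT (fun w => f w k 0).
  apply: (measurableT_comp (f := fun x : 'cV[R]_p => x k 0)) => //.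
  exact: measurable_coord.
by apply: measurable_sum => k; exact: measurable_funM.
Qed.

Lemma measurable_dcoef d (T : measurableType d) (R : realType) (p K : nat)
    (mu : 'I_K -> 'cV[R]_p) (S : 'M[R]_p)
    (a b : T -> 'I_K -> 'I_K -> 'cV[R]_p) j i :
  measurable_fun setT (fun w => a w j i) ->
  measurable_fun setT (fun w => b w j i) ->
  measurable_fun setT (fun w => dcoef mu S (a w) (b w) j i).
Proof.
move=> ma mb; rewrite /dcoef; under eq_fun do rewrite dotE.
have mc (f : T -> 'cV[R]_p) k : measurable_fun setT f ->
    measurable_fun setT (fun w => f w k 0).
  move=> mf; apply: (measurableT_comp (f := fun x : 'cV[R]_p => x k 0)) => //.
  exact: measurable_coord.
apply: measurable_sum => k; apply: measurable_funM; first exact: mc.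
under eq_fun do rewrite mxE.
apply: measurable_sum => l; apply: measurable_funM => //.
under eq_fun do rewrite !mxE.
by apply: measurable_funB => //; exact: mc.
Qed.

(** * Passage to bounds in probability *)

Theorem theorem3p2 (R : realType)
  (* dimensions, numbers of classes, sample sizes, indexed by the total size *)
  (p K : nat -> nat) (m : forall n, 'I_(K n) -> nat)
  (K_ge2 : forall n, (2 <= K n)%N)
  (m_total : forall n, (\sum_(i < K n) m n i)%N = n)
  (p_infty : p @ \oo --> \oo)
  (* parameters and distributions of the classes *)
  (mu : forall n, 'I_(K n) -> 'cV[R]_(p n))
  (Sigma S : forall n, 'M[R]_(p n))
  (Sigma_posdef : forall n, posdef (Sigma n))
  (S_inv_sqrt : forall n, is_inv_sqrt (Sigma n) (S n))
  (nu : forall n, 'I_(K n) -> probability 'cV[R]_(p n) R)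
  (nu_normal : forall n i, is_normal (nu n i) (mu n i) (Sigma n))
  (* the sample *)
  (d : nat -> measure_display) (Omega : forall n, measurableType (d n))
  (P : forall n, probability (Omega n) R)
  (X : forall n, {i : 'I_(K n) & 'I_(m n i)} -> {RV (P n) >-> 'cV[R]_(p n)})
  (X_law : forall n k B, measurable B ->
     distribution (P n) (X n k) B = nu n (tag k) B)
  (X_indep : forall n, mutually_independent (X n))
  (* (i), (ii), (iii) *)
  (c0 c1 : R) (s : nat -> R)
  (Sigma_bounds : forall n,
     [/\ 1 / c0 <= lambda_min (Sigma n),
         lambda_min (Sigma n) <= lambda_max (Sigma n)
       & lambda_max (Sigma n) <= c0])
  (c1_gt0 : 0 < c1)
  (mu_separated : forall n i j, i != j ->
     c1 <= mahalanobis2 (Sigma n) (mu n i) (mu n j))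
  (s_gt0 : forall n, 0 < s n)
  (Ms_cvg0 : (fun n => Mmax (mu n) (Sigma n) * s n) @ \oo --> (0 : R))
  (* the rule T, as a function of the sample *)
  (ah bh : forall n, sample R (p n) (m n) -> 'I_(K n) -> 'I_(K n) ->
     'cV[R]_(p n))
  (ah_measurable : forall n j i,
     measurable_fun setT (fun w : Omega n => ah n (fun k => X n k w) j i))
  (bh_measurable : forall n j i,
     measurable_fun setT (fun w : Omega n => bh n (fun k => X n k w) j i))
  (ah_antisym : forall n x j i, j != i -> ah n x j i = - ah n x i j)
  (bh_sym : forall n x j i, j != i -> bh n x j i = bh n x i j)
  (* the orthogonal decomposition of a_{ji} *)
  (t : forall n, sample R (p n) (m n) -> 'I_(K n) -> 'I_(K n) -> R)
  (aperp : forall n, sample R (p n) (m n) -> 'I_(K n) -> 'I_(K n) ->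
     'cV[R]_(p n))
  (t_measurable : forall n j i,
     measurable_fun setT (fun w : Omega n => t n (fun k => X n k w) j i))
  (a_decomp : forall n x j i, j != i ->
     orth_decomposition (avec (mu n) (S n) j i)
       (t n x j i) (ah n x j i) (aperp n x j i))
  (a_rate : is_Op_unif P
     (fun n j i w => sqnorm (avec (mu n) (S n) j i)
                     - sqnorm (ah n (fun k => X n k w) j i))
     (fun n j i w => sqnorm (avec (mu n) (S n) j i)) s)
  (t_rate : is_Op_unif P
     (fun n j i w => t n (fun k => X n k w) j i - 1)
     (fun n j i w => 1) s)
  (d_rate : is_Op_unif P
     (fun n j i w =>
        dcoef (mu n) (S n) (avec (mu n) (S n)) (bvec (mu n)) j i
        - dcoef (mu n) (S n) (ah n (fun k => X n k w))
            (bh n (fun k => X n k w)) j i)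
     (fun n j i w => sqnorm (ah n (fun k => X n k w) j i)) s) :
  is_Op P
    (fun n w =>
       misclassification_rate (nu n)
         (linear_rule (S n) (ah n (fun k => X n k w)) (bh n (fun k => X n k w)))
       / misclassification_rate (nu n) (opt_rule (mu n) (Sigma n)) - 1)
    (fun n => (K n)%:R ^+ 2 *
       Num.sqrt (Mmax (mu n) (Sigma n) * s n *
                 ln ((Mmax (mu n) (Sigma n) * s n)^-1))).
Proof.
move=> e e0.
have e30 : 0 < e / 3 by rewrite divr_gt0.
have [Ca nearA] := a_rate _ e30.
have [Ct nearT] := t_rate _ e30.
have [Cd nearD] := d_rate _ e30.
(* One nonnegative constant for all three rates, each of which may fail with probability [e / 3]. *)
pose C := Num.max 0 (Num.max Ca (Num.max Ct Cd)).
have C0 : 0 <= C by rewrite /C le_max lexx.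
have CaC : Ca <= C by rewrite /C !le_max lexx ?orbT.
have CtC : Ct <= C by rewrite /C !le_max lexx ?orbT.
have CdC : Cd <= C by rewrite /C !le_max lexx ?orbT.
(* The first bound on [Mmax * s] makes the logarithm at least 1; the second gives
   [C * s n <= 1 / 4], because [c1 * s n <= Mmax * s n]. *)
pose del := Num.min (expR (-1)) (c1 / (4 * (C + 1))).
have C1 : 0 < 4 * (C + 1) by lra.
have del0 : 0 < del by rewrite /del lt_min expR_gt0 divr_gt0.
exists (ratio_constant C c1).
have nearM : \forall n \near \oo, `|Mmax (mu n) (Sigma n) * s n| < del.
  exact: cvgr0_norm_lt Ms_cvg0 _ del0.
apply: filterS (filterI (filterI nearA nearT) (filterI nearD nearM)).
move=> n [[PA PB] [PD Mlt]].
pose A := fun w => exists j i, j != i /\ Ca * s n * sqnorm (avec (mu n) (S n) j i) <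
  `|sqnorm (avec (mu n) (S n) j i) - sqnorm (ah n (fun k => X n k w) j i)|.
pose B := fun w => exists j i, j != i /\ Ct * s n * 1 <
  `|t n (fun k => X n k w) j i - 1|.
pose D := fun w => exists j i, j != i /\
  Cd * s n * sqnorm (ah n (fun k => X n k w) j i) <
  `|dcoef (mu n) (S n) (avec (mu n) (S n)) (bvec (mu n)) j i -
    dcoef (mu n) (S n) (ah n (fun k => X n k w)) (bh n (fun k => X n k w)) j i|.
have Mc1 : c1 <= Mmax (mu n) (Sigma n).
  exact: (Mmax_ge (S_inv_sqrt n) (K_ge2 n) (@mu_separated n)).
have sn0 := s_gt0 n.
have q0 : 0 < Mmax (mu n) (Sigma n) * s n by rewrite mulr_gt0// (lt_le_trans c1_gt0).
rewrite gtr0_norm// /del lt_min in Mlt; case/andP: Mlt => q1 q2.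
set q := Mmax (mu n) (Sigma n) * s n in q0 q1 q2 *.
have cq : c1 * s n <= q by rewrite /q ler_pM2r.
have Cs : C * s n <= 1 / 4.
  rewrite ltr_pdivlMr// in q2.
  have h : c1 * s n * (4 * (C + 1)) < c1.
    by apply: le_lt_trans q2; rewrite ler_pM2r.
  have : s n * (4 * (C + 1)) < 1 by rewrite -(ltr_pM2l c1_gt0) mulr1 mulrA.
  by lra.
have q_le1 : q <= 1 by rewrite ltW// (lt_le_trans q1)// -expR0 ler_expR; lra.
have lnq : 1 <= ln q^-1.
  rewrite -[leLHS]expRK ler_ln ?posrE ?expR_gt0 ?invr_gt0//.
  by rewrite -[leLHS]invrK lef_pV2 ?posrE ?invr_gt0 ?expR_gt0// -expRN ltW.
have mA : measurable A.
  apply: measurable_exists_lt => j i //.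
  apply: measurableT_comp => //; apply: measurable_funB => //.
  exact: measurable_sqnorm.
have mB : measurable B.
  apply: measurable_exists_lt => j i //.
  by apply: measurableT_comp => //; exact: measurable_funB.
have mD : measurable D.
  apply: measurable_exists_lt => j i.
    by apply: measurable_funM => //; exact: measurable_sqnorm.
  apply: measurableT_comp => //; apply: measurable_funB => //.
  exact: measurable_dcoef.
apply: (@le_trans _ _ (P n (A `|` (B `|` D)))); last first.
  have -> : e%:E = ((e / 3)%:E + ((e / 3)%:E + (e / 3)%:E))%E.
    by rewrite -!EFinD; congr EFin; lra.
  apply: (@le_trans _ _ (P n A + P n (B `|` D))%E).
    by apply: measureU2 => //; exact: measurableU.
  apply: leeD => //; apply: (@le_trans _ _ (P n B + P n D)%E).
    exact: measureU2.
  exact: leeD.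
apply: le_measure; rewrite ?inE//.
- rewrite -[X in measurable X]setTI; apply: measurable_fun_ltr => //.
  apply: measurableT_comp => //; apply: measurable_funB => //.
  apply: measurable_funM => //.
  exact: measurable_misclassification_rate.
- by apply: measurableU => //; exact: measurableU.
(* Outside the three exceptional events the bound for a fixed sample applies. *)
move=> w /= hw; apply: contrapT => /not_orP[nA /not_orP[nB nD]].
move: hw; apply/negP; rewrite -leNgt.
have bound (C' f x : R) : C' <= C -> 0 <= f ->
    ~ (C' * s n * f < x) -> x <= C * s n * f.
  move=> CC f0 /negP; rewrite -leNgt => /le_trans; apply.
  by rewrite ler_wpM2r// ler_wpM2r// ltW.
have closeA j i : j != i ->
    `|sqnorm (avec (mu n) (S n) j i) - sqnorm (ah n (fun k => X n k w) j i)| <=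
    C * s n * sqnorm (avec (mu n) (S n) j i).
  by move=> ji; apply: bound CaC (sqnorm_ge0 _) _ => h; apply: nA; exists j, i.
have closeT j i : j != i -> `|t n (fun k => X n k w) j i - 1| <= C * s n.
  move=> ji; rewrite -[leRHS]mulr1.
  by apply: bound CtC ler01 _ => h; apply: nB; exists j, i.
have closeD j i : j != i ->
    `|dcoef (mu n) (S n) (avec (mu n) (S n)) (bvec (mu n)) j i -
      dcoef (mu n) (S n) (ah n (fun k => X n k w)) (bh n (fun k => X n k w)) j i| <=
    C * s n * sqnorm (ah n (fun k => X n k w) j i).
  by move=> ji; apply: bound CdC (sqnorm_ge0 _) _ => h; apply: nD; exists j, i.
have := misclassification_ratio_le (Sigma_posdef n) (S_inv_sqrt n) (nu_normal n)
  (K_ge2 n) C0 sn0 c1_gt0 (mu_separated n)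
  (a_decomp n (fun k => X n k w)) Cs q_le1 closeA closeT closeD.
move=> /le_trans; apply.
rewrite mulrCA ler_wpM2l ?ratio_constant_ge0//.
(* The bound obtained is [K] times the root of [q]; the stated rate is larger, as [K <= K ^+ 2] and
   [q <= q * ln q^-1]. *)
apply: ler_pM; rewrite ?ler0n ?sqrtr_ge0//.
  by rewrite expr2 ler_peMr ?ler0n// ler1n (ltn_trans _ (K_ge2 n)).
by rewrite ler_sqrt ?ler_peMr ?(ltW q0)// mulr_ge0 ?(ltW q0)// (le_trans ler01).
Qed.
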